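(* Let $A\in\mathbb{R}^{d\times d}$ with spectral radius $\rho(A)<1$, and consider the system $x_0=0$, $x_{s+1}=Ax_s+\eta_{s+1}$ for $s\ge 0$, where $(\eta_s)_{s\ge1}$ are i.i.d. zero-mean isotropic random vectors in $\mathbb{R}^d$ (i.e. $\mathbb{E}\eta_s\eta_s^\top=I_d$) with independent coordinates whose $\psi_2$-norms are at most $K$. For $t\ge1$ let $$A_t=\Big(\sum_{s=0}^{t} x_{s+1}x_s^\top\Big)\Big(\sum_{s=0}^{t} x_s x_s^\top\Big)^{\dagger}$$ be the ordinary least squares estimator built from $(x_1,\dots,x_{t+1})$. Then there is a universal constant $c'>0$ such that, with $c=c'K^4$, for any $0<\delta<1$ and any $\varepsilon>0$, $$\mathbb{P}\left(\|A_t-A\|>\varepsilon\right)<\delta$$ as long as $$\lambda_{\min}\Big(\sum_{s=0}^{t-1}\Gamma_s(A)\Big)\ge c\max\Big\{\frac{1}{\varepsilon^2},\|\Gamma\|^2\Big\}\Big(\log\frac1\delta+d\Big).$$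
   Context: $\|\cdot\|$ denotes the operator norm for matrices; $W^\dagger$ is the Moore–Penrose pseudo-inverse; $\lambda_{\min}$ is the smallest eigenvalue. The $\psi_2$-norm of a real random variable $Y$ is $\inf\{K\ge0:\mathbb{E}\exp(Y^2/K^2)\le2\}$. $\Gamma_s(A)=\sum_{k=0}^{s}A^k(A^k)^\top$ (finite-time controllability gramian). $\Gamma$ is the $td\times td$ block lower-triangular Toeplitz matrix whose $(i,j)$ block ($1\le i,j\le t$, blocks of size $d\times d$) equals $A^{i-j}$ if $i\ge j$ and $0$ otherwise (so diagonal blocks are $I_d$). *)

(* Defs.v *)
From HB Require Import structures.
From mathcomp Require Import all_boot all_order all_algebra.
From mathcomp Require Import all_classical all_reals all_analysis.
Set Implicit Arguments. Unset Strict Implicit. Unset Printing Implicit Defensive.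
Import Order.TTheory GRing.Theory Num.Theory.
Import numFieldNormedType.Exports.
Local Open Scope classical_set_scope.
Local Open Scope ring_scope.

Section LinAlg.
Variable R : realType.

Definition enorm (n : nat) (x : 'cV[R]_n) : R :=
  Num.sqrt (\sum_(i < n) x i 0 ^+ 2).

Definition opnorm (m n : nat) (M : 'M[R]_(m, n)) : R :=
  sup [set enorm (M *m x) | x in [set x : 'cV[R]_n | enorm x <= 1]].

Definition penrose (m n : nat) (M : 'M[R]_(m, n)) (X : 'M[R]_(n, m)) : Prop :=
  [/\ M *m X *m M = M, X *m M *m X = X,
      (M *m X)^T = M *m X & (X *m M)^T = X *m M].

Definition pinv (m n : nat) (M : 'M[R]_(m, n)) : 'M[R]_(n, m) :=
  xget 0 [set X | penrose M X].

Definition lambda_min (n : nat) (M : 'M[R]_n) : R :=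
  inf [set a : R | eigenvalue M a].

(* (a + i b) is a complex eigenvalue of the real matrix A: there is a nonzero
   complex vector u + i v with A (u + i v) = (a + i b)(u + i v). *)
Definition complex_eigenvalue (n : nat) (A : 'M[R]_n) (a b : R) : Prop :=
  exists u v : 'cV[R]_n, (u != 0 \/ v != 0) /\
    A *m u = a *: u - b *: v /\ A *m v = b *: u + a *: v.

Definition spectral_radius (n : nat) (A : 'M[R]_n) : R :=
  sup [set r : R | exists a b : R,
        complex_eigenvalue A a b /\ r = Num.sqrt (a ^+ 2 + b ^+ 2)].

Definition gramian (n : nat) (A : 'M[R]_n) (s : nat) : 'M[R]_n :=
  \sum_(k < s.+1) (A ^+ k *m (A ^+ k)^T).

Definition toeplitz_Gamma (d : nat) (A : 'M[R]_d) (t : nat) :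
  'M[R]_(\sum_(i < t) d, \sum_(j < t) d) :=
  \mxblock_(i < t, j < t) (if (j <= i)%N then A ^+ (i - j) else 0).

End LinAlg.

Section Prob.
Context {R : realType} {dT : measure_display} {T : measurableType dT}.
Variable P : probability T R.

(* psi_2 (Orlicz) norm, with value +oo if the defining set is empty *)
Definition psi2norm (Y : T -> R) : \bar R :=
  ereal_inf [set k%:E | k in [set k : R | 0 < k /\
     ('E_P[fun w => expR (Y w ^+ 2 / k ^+ 2)] <= 2%:E)%E]].

Definition mutually_independent (I : eqType) (X : I -> T -> R) : Prop :=
  forall (J : seq I) (B : I -> set R), uniq J ->
    (forall i, measurable (B i)) ->
    P (\bigcap_(i in [set i | i \in J]) (X i @^-1` B i)) =
    (\prod_(i <- J) P (X i @^-1` B i))%E.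

End Prob.

Fixpoint state {R : realType} {T : Type} (d : nat) (A : 'M[R]_d)
  (eta : nat -> T -> 'cV[R]_d) (s : nat) (w : T) : 'cV[R]_d :=
  match s with
  | 0 => 0
  | s'.+1 => A *m state A eta s' w + eta s'.+1 w
  end.

Definition ols {R : realType} {T : Type} (d : nat) (A : 'M[R]_d)
  (eta : nat -> T -> 'cV[R]_d) (t : nat) (w : T) : 'M[R]_d :=
  (\sum_(s < t.+1) (state A eta s.+1 w *m (state A eta s w)^T)) *m
  pinv (\sum_(s < t.+1) (state A eta s w *m (state A eta s w)^T)).

(* Main.v *)
Require Import Defs.
From HB Require Import structures.
From mathcomp Require Import all_boot all_order all_algebra.
From mathcomp Require Import all_classical all_reals all_analysis.
From mathcomp Require Import measurable_realfun lra ring.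
Import Order.TTheory GRing.Theory Num.Theory.
Import numFieldNormedType.Exports.
Local Open Scope classical_set_scope.
Local Open Scope ring_scope.

(** For [z] in the unit ball put [v = W z], where [W] is a change of basis with
    [W^T Sigma W = 1] and [Sigma = \sum_(s < t) Gamma_s(A)] is the expected Gram
    matrix of the trajectory.  Both the normalized deviation [W^T (V - Sigma) W]
    of the empirical Gram matrix [V] and the normalized noise-state correlation
    [S W], tested against two fixed vectors, are centred quadratic forms in the
    independent coordinates of the noise.  Their operator norms are controlled
    by [|Gamma|] and [lambda_min Sigma], and their Frobenius norms by 1, so the
    Hanson-Wright inequality applies to both; a union bound over a 1/4-net of the
    unit ball extends the bounds to all directions.  On the resulting event
    [V >= Sigma / 2], and the error [S V^-1] is at most [eps].

    Hanson-Wright is proved without Gaussian comparison or decoupling: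
    integrating out one coordinate of the noise replaces the matrix of the form
    by a rank-one perturbation of the remaining block, and this perturbation is
    dominated by a Schur complement, so the bound on the form is preserved. *)

Set Implicit Arguments.
Unset Strict Implicit.

(** The Hanson-Wright induction closes because of a budget. A coordinate with off-diagonal row [s]
    contributes [2 |s|^2] to the squared Frobenius norm. Integrating it out raises the trace of the
    remaining block by [4 C |s|^2] and its squared Frobenius norm by at most [|s|^2]. As the
    Frobenius term has weight [4 C] in the exponent, each increase takes one half of what is
    released. The one-coordinate estimate has [C] of order [K^4], which is the source of the factor
    [K^4] in the hypothesis on [lambda_min].

    The two families of forms are used at different scales. The covariance deviation need only stay
    below a constant, so its exponential parameter is taken as large as the operator norm allows, up
    to a constant. The noise-state correlation has size [K^2 sqrt L] with [L = log (1/delta) + d],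
    and is beaten by [eps sqrt lambda_min].

    A separate obstacle is measurability of the failure event: the pseudo-inverse is discontinuous,
    so it is handled as a pointwise limit of Tikhonov regularizations. *)

Local Notation pinv := Defs.pinv.

(** * Independence *)

Section Independence.
Context {R : realType} {dT : measure_display} {T : measurableType dT}.
Variables (P : probability T R) (I : eqType) (X : I -> T -> R).
Hypothesis mX : forall i, measurable_fun setT (X i).
Hypothesis indX : mutually_independent P X.

(** A pi-system generating the sigma-algebra of the coordinates in [J]; the values of [B] outside
    [J] are irrelevant. *)
Definition cylinder (J : seq I) : set (set T) :=
  [set A | exists B : I -> set R, (forall i, measurable (B i)) /\
     A = \bigcap_(i in [set i | i \in J]) (X i @^-1` B i)].

Lemma measurable_cylinder J : cylinder J `<=` measurable.
Proof.
move=> _ [B [mB ->]]; apply: fin_bigcap_measurable.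
  exact: finite_seq.
by move=> i _; rewrite -[X in measurable X]setTI; exact: mX.
Qed.

Lemma setI_closed_cylinder J : setI_closed (cylinder J).
Proof.
move=> _ _ [B [mB ->]] [C [mC ->]]; exists (fun i => B i `&` C i); split.
  by move=> i; exact: measurableI.
apply/seteqP; split => w.
  by move=> [Bw Cw] i iJ; split; [exact: Bw|exact: Cw].
by move=> BCw; split => i iJ; have [] := BCw i iJ.
Qed.

Lemma measurable_fun_cylinder J i : i \in J ->
  measurable_fun (setT : set (g_sigma_algebraType (cylinder J))) (X i).
Proof.
move=> iJ _ B mB; rewrite setTI; apply: sub_sigma_algebra.
exists (fun j => if j == i then B else setT); split.
  by move=> j; case: ifP.
apply/seteqP; split => w /=.
  by move=> Bw j jJ; case: eqP => [->|].
by move=> /(_ i iJ); rewrite eqxx.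
Qed.

(** For fixed [B], both sides are finite measures in [A] that agree on a pi-system, hence on the
    sigma-algebra it generates. *)
Lemma indep_cylinder_sigma (i : I) (J : seq I) (A : set T) (B : set R) :
  uniq (i :: J) -> <<s cylinder J >> A -> measurable B ->
  P (A `&` X i @^-1` B) = (P A * P (X i @^-1` B))%E.
Proof.
move=> uJ sA mB.
have mXB : measurable (X i @^-1` B) by rewrite -[X in measurable X]setTI; exact: mX.
pose p : {nonneg R} := NngNum (fine_ge0 (measure_ge0 P (X i @^-1` B))).
have pE : (p%:num%:E = P (X i @^-1` B))%E by rewrite /= fineK// fin_num_measure.
rewrite muleC -pE.
apply: (@g_sigma_algebra_measure_unique _ R T (cylinder J)
  (@measurable_cylinder J) (fun _ => setT) _ _
  (mrestr P mXB) (mscale p P) (@setI_closed_cylinder J) _ _ _ sA).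
- move=> _; exists (fun _ => setT); split => //.
  by apply/seteqP; split.
- by apply/seteqP; split => // w _; exists 0%N.
- move=> _ [C [mC ->]].
  change (P ((\bigcap_(j in [set j | j \in J]) X j @^-1` C j) `&` X i @^-1` B) =
    (p%:num%:E * P (\bigcap_(j in [set j | j \in J]) X j @^-1` C j))%E).
  rewrite pE.
  move: uJ; rewrite /= => /andP[iJ uJ].
  rewrite [in RHS]indX// muleC.
  (* The constraint on [X i] joins the family, so that independence applies once to [i :: J] and
     once to [J]. *)
  pose C' j := if j == i then B else C j.
  have mC' j : measurable (C' j) by rewrite /C'; case: ifP.
  transitivity (P (\bigcap_(j in [set j | j \in i :: J]) (X j @^-1` C' j))).
    congr (P _); apply/seteqP; split => w.
      move=> [Cw Bw] j /=; rewrite inE /C'; case: eqP => [->//|_ /= jJ].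
      exact: Cw.
    move=> Cw; split => [j jJ|].
      have := Cw j; rewrite /C' /= inE jJ orbT; case: eqP => [ji|_]; last exact.
      by move: iJ; rewrite -ji jJ.
    by have := Cw i; rewrite /C' /= inE eqxx; apply.
  rewrite indX ?big_cons//=; last by rewrite iJ.
  rewrite /C' eqxx muleC; congr (_ * _)%E.
  rewrite big_seq [RHS]big_seq; apply: eq_bigr => j jJ.
  by case: eqP => // ji; move: iJ; rewrite -ji jJ.
- move=> _; change (P (setT `&` X i @^-1` B) < +oo)%E.
  by rewrite (le_lt_trans (probability_le1 P _))// ?ltry//; rewrite setTI.
Qed.

Lemma measurable_id_cylinder (J : seq I) :
  measurable_fun setT (idfun : T -> g_sigma_algebraType (cylinder J)).
Proof.
move=> _ A mA; rewrite setTI preimage_id.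
apply: (smallest_sub _ _ mA); first exact: sigma_algebra_measurable.
exact: measurable_cylinder.
Qed.

(** After transport to the law of [X i], the inner integral is a Tonelli section, measurable already
    for the cylinder sigma-algebra. *)
Lemma measurable_integral_section (i : I) (J : seq I)
    (f : (g_sigma_algebraType (cylinder J) * R)%type -> \bar R) :
  measurable_fun setT f -> (forall x, 0 <= f x)%E ->
  measurable_fun (setT : set T) (fun w => \int[P]_v f (w, X i v))%E.
Proof.
move=> mf f0.
pose Xm : {mfun T >-> R} := HB.pack (X i)
  (isMeasurableFun.Build _ _ _ _ _ (mX i)).
have mF : measurable_fun setT (fubini_F (distribution P Xm) f).
  exact: measurable_fun_fubini_tonelli_F.
have := measurableT_comp mF (@measurable_id_cylinder J).
apply: eq_measurable_fun => w _ /=.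
rewrite /fubini_F ge0_integral_distribution//.
exact: measurableT_comp.
Qed.

(** The block [J] is represented by the identity map into [T] with the cylinder sigma-algebra.
    Independence makes its joint law with [X i] a product measure, and Tonelli concludes. *)
Lemma integral_indep (i : I) (J : seq I)
    (f : (g_sigma_algebraType (cylinder J) * R)%type -> \bar R) :
  uniq (i :: J) -> measurable_fun (setT : set (g_sigma_algebraType (cylinder J) * R)%type) f ->
  (forall x, 0 <= f x)%E ->
  (\int[P]_w f (w, X i w) = \int[P]_w \int[P]_v f (w, X i v))%E.
Proof.
move=> uJ mf f0.
pose TJ := g_sigma_algebraType (cylinder J).
have midT : measurable_fun setT (idfun : T -> TJ) by exact: measurable_id_cylinder.
pose idm : {mfun T >-> TJ} := HB.pack (idfun : T -> TJ)
  (isMeasurableFun.Build _ _ _ _ _ midT).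
pose Xm : {mfun T >-> R} := HB.pack (X i)
  (isMeasurableFun.Build _ _ _ _ _ (mX i)).
have mpair : measurable_fun setT (fun w : T => ((w : TJ), X i w)).
  exact: (measurable_fun_pair midT (mX i)).
pose pm : {mfun T >-> (TJ * R)%type} := HB.pack (fun w : T => ((w : TJ), X i w))
  (isMeasurableFun.Build _ _ _ _ _ mpair).
pose m1 := distribution P idm.
pose m2 := distribution P Xm.
transitivity (\int[distribution P pm]_x f x)%E.
  by rewrite ge0_integral_distribution.
transitivity (\int[m1 \x m2]_x f x)%E.
  apply: eq_measure_integral => A mA _; apply/esym.
  apply: product_measure_unique => // A1 A2 mA1 mA2.
  exact: (indep_cylinder_sigma uJ mA1 mA2).
rewrite fubini_tonelli1//= ge0_integral_distribution//=.
- apply: eq_integral => w _; rewrite /fubini_F ge0_integral_distribution//.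
  exact: measurableT_comp.
- exact: measurable_fun_fubini_tonelli_F.
- by move=> w; exact: integral_ge0.
Qed.

End Independence.

(** * Moment generating function of one coordinate *)

Section OneDim.
Context {R : realType}.

(** Everything follows from [e^w (1 - w) <= 1], multiplied by [w] when [w >= 0]. *)
Lemma expR_le_quadratic (w : R) : expR w <= 1 + w + w ^+ 2 * expR `|w|.
Proof.
have h1 : expR w * (1 - w) <= 1.
  have := expR_ge1Dx (- w); rewrite expRN => h.
  by rewrite -ler_pdivlMl ?expR_gt0// mulr1.
have h2 := expR_ge1Dx w.
have [w0|w0] := leP 0 w.
  rewrite ger0_norm//; have : w * (expR w * (1 - w)) <= w * 1 by rewrite ler_wpM2l.
  by nra.
have h3 : 1 <= expR `|w| by rewrite -expR0 ler_expR.
by nra.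
Qed.

(** The smallness of [al] and [be] gives [|w| <= 1/8 + 3/8 u^2]. The remaining [5/8 u^2] in the
    exponent of [expR (u ^+ 2)], split as the square of [expR (5/16 * u ^+ 2)], absorbs the
    polynomial factor [w^2] of degree 4 in [u]. *)
Lemma expR_quadratic_dominated (al be u w : R) : 0 <= al <= 1/4 -> 0 <= be <= 1/4 ->
  0 <= u -> `|w| <= al * u + be * u ^+ 2 ->
  expR w <= 1 + w + 24 * (al ^+ 2 + be ^+ 2) * expR (u ^+ 2).
Proof.
move=> /andP[al0 al1] /andP[be0 be1] u0 hw.
apply: (le_trans (expR_le_quadratic w)); rewrite lerD2l.
have e1 : expR (1/8 : R) <= 8/7.
  have := expR_ge1Dx (- (1/8) : R); rewrite expRN => h.
  have e0 := expR_gt0 (1/8 : R).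
  have e00 := mulVf (lt0r_neq0 e0).
  have : expR (1/8) * (1 + - (1/8)) <= expR (1/8) * (expR (1/8))^-1 :> R.
    by rewrite ler_wpM2l// ltW.
  by rewrite mulrC in e00; rewrite e00; lra.
have e2 : expR `|w| <= expR (1/8) * expR (3/8 * u ^+ 2).
  rewrite -expRD ler_expR; apply: (le_trans hw).
  have : 0 <= (u - 1) ^+ 2 by rewrite sqr_ge0.
  have := sqr_ge0 u.
  by nra.
have E0 := expR_gt0 (5/16 * u ^+ 2).
have e3 : u ^+ 2 * (5/16) <= expR (5/16 * u ^+ 2).
  by have := expR_ge1Dx (5/16 * u ^+ 2); lra.
have e5 : 1 <= expR (5/16 * u ^+ 2).
  by rewrite -expR0 ler_expR mulr_ge0// ?sqr_ge0//; lra.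
have -> : expR (u ^+ 2) =
    expR (3/8 * u ^+ 2) * (expR (5/16 * u ^+ 2)) ^+ 2.
  by rewrite -expRM_natl -expRD; congr expR; field.
have w2 : w ^+ 2 <= 2 * (al ^+ 2 * u ^+ 2 + be ^+ 2 * u ^+ 4).
  rewrite -real_normK ?num_real//.
  have : `|w| ^+ 2 <= (al * u + be * u ^+ 2) ^+ 2 by rewrite lerXn2r// nnegrE; nra.
  have := sqr_ge0 (al * u - be * u ^+ 2).
  by nra.
set E := expR (5/16 * u ^+ 2) in E0 e3 e5 *.
set F := expR (3/8 * u ^+ 2) in e2 *.
have F0 : 0 < F by exact: expR_gt0.
have u20 := sqr_ge0 u.
have s2 : u ^+ 2 <= 10 * E ^+ 2 by nra.
have s4 : u ^+ 4 <= (41/4) * E ^+ 2.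
  have -> : u ^+ 4 = (u ^+ 2) ^+ 2 by rewrite -exprM.
  have : (u ^+ 2 * (5/16)) ^+ 2 <= E ^+ 2.
    by rewrite lerXn2r// nnegrE; nra.
  by rewrite exprMn; nra.
have w3 : w ^+ 2 <= (41/2) * (al ^+ 2 + be ^+ 2) * E ^+ 2.
  apply: (le_trans w2).
  have := sqr_ge0 al; have := sqr_ge0 be.
  by nra.
apply: (le_trans (ler_wpM2l (sqr_ge0 w) e2)).
have h4 : expR (1 / 8) * F <= 8/7 * F by rewrite ler_wpM2r// ltW.
apply: (le_trans (ler_wpM2l (sqr_ge0 w) h4)).
have h5 : w ^+ 2 * (8/7 * F) <= (41/2) * (al ^+ 2 + be ^+ 2) * E ^+ 2 * (8/7 * F).
  by rewrite ler_wpM2r//; lra.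
apply: (le_trans h5).
have h6 : 0 <= (al ^+ 2 + be ^+ 2) * E ^+ 2 * F.
  by rewrite !mulr_ge0// ?addr_ge0 ?sqr_ge0// ltW.
by nra.
Qed.

Context {dT : measure_display} {T : measurableType dT}.
Variable P : probability T R.

Lemma mgf_linear_quadratic (Y : T -> R) (k a b : R) :
  measurable_fun setT Y -> 1 <= k ->
  (\int[P]_w (Y w)%:E = 0)%E -> (\int[P]_w (Y w ^+ 2)%:E = 1)%E ->
  (\int[P]_w (expR (Y w ^+ 2 / k ^+ 2))%:E <= 2%:E)%E ->
  `|b| <= (4 * k ^+ 2)^-1 ->
  (\int[P]_w (expR (a * Y w + b * Y w ^+ 2))%:E <=
     (expR (b + 64 * k ^+ 4 * (a ^+ 2 + b ^+ 2)))%:E)%E.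
Proof.
move=> mY k1 EY EY2 Eg hb.
have k0 : 0 < k by lra.
have k20 : 0 < k ^+ 2 by exact: exprn_gt0.
have k21 : 1 <= k ^+ 2 by rewrite exprn_ege1.
have k41 : 1 <= k ^+ 4 by rewrite exprn_ege1.
have k42 : k ^+ 2 <= k ^+ 4 by rewrite ler_weXn2l.
pose g w := expR (Y w ^+ 2 / k ^+ 2).
have mY2 : measurable_fun setT (fun w => Y w ^+ 2) by exact: measurable_funX.
have mg : measurable_fun setT g.
  by apply: measurableT_comp => //; exact: measurable_funM.
have me : measurable_fun setT (fun w => expR (a * Y w + b * Y w ^+ 2)).
  apply: measurableT_comp => //; apply: measurable_funD; exact: measurable_funM.
have ig : P.-integrable setT (EFin \o g).
  apply/integrableP; split; first exact/measurable_EFinP.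
  apply: (@le_lt_trans _ _ 2%:E); last exact: ltry.
  apply: le_trans Eg; rewrite le_eqVlt; apply/orP; left; apply/eqP.
  by apply: eq_integral => w _ /=; rewrite ger0_norm// expR_ge0.
have iY2 : P.-integrable setT (EFin \o (fun w => Y w ^+ 2)).
  apply/integrableP; split; first exact/measurable_EFinP.
  rewrite (_ : (\int[P]_w _)%E = 1%E) ?ltry// -EY2.
  by apply: eq_integral => w _ /=; rewrite ger0_norm ?sqr_ge0.
have i1 : P.-integrable setT (EFin \o (fun=> 1 : R)).
  exact: finite_measure_integrable_cst.
have iY : P.-integrable setT (EFin \o Y).
  apply: (le_integrable measurableT _ _ (integrableD measurableT i1 iY2)).
    exact/measurable_EFinP.
  move=> w _ /=; rewrite lee_fin; rewrite [leRHS]ger0_norm ?addr_ge0 ?sqr_ge0//.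
  rewrite -(real_normK (num_real (Y w))).
  by have := sqr_ge0 (`|Y w| - 1); nra.
have b2 : `|b| * k ^+ 2 <= 1/4.
  have := ler_wpM2r (ltW k20) hb.
  rewrite invfM -mulrA mulVf ?gt_eqF//; lra.
have b14 : `|b| <= 1/4 by have := normr_ge0 b; nra.
have bb : - `|b| <= b by have := ler_norm (- b); rewrite normrN; lra.
have [u [u0 u2 Yw]] : exists u : T -> R, [/\ forall w, 0 <= u w,
    forall w, u w ^+ 2 = Y w ^+ 2 / k ^+ 2 & forall w, `|Y w| = k * u w].
  exists (fun w => `|Y w| / k); split => w.
  - by rewrite divr_ge0// ltW.
  - by rewrite expr_div_n real_normK ?num_real.
  - by rewrite mulrC divfK// gt_eqF.
(* The threshold is the smallness required of [al] in [expR_quadratic_dominated], used with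
   [u = |Y| / k]. *)
have [ak|ak] := leP (`|a| * k) (1/4).
- apply: (@le_trans _ _ (\int[P]_w (1 + a * Y w + b * Y w ^+ 2 +
      24 * ((`|a| * k) ^+ 2 + (`|b| * k ^+ 2) ^+ 2) * g w)%:E)%E).
    apply: ge0_le_integral => //.
    + exact/measurable_EFinP.
    + apply/measurable_EFinP; apply: measurable_funD; last exact: measurable_funM.
      by apply: measurable_funD; [apply: measurable_funD => //|]; exact: measurable_funM.
    + move=> w _; rewrite lee_fin -[1 + _ + _]addrA /g -u2.
      apply: expR_quadratic_dominated => //.
      * by rewrite mulr_ge0// ltW.
      * by rewrite b2 mulr_ge0// ltW.
      * apply: (le_trans (ler_normD _ _)); rewrite normrM [X in _ + X]normrM normrX Yw exprMn.
        by rewrite !mulrA.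
  set M := 24 * _.
  have -> : (fun w => (1 + a * Y w + b * Y w ^+ 2 + M * g w)%:E) =
     (fun w => 1%:E + a%:E * (Y w)%:E + b%:E * (Y w ^+ 2)%:E + M%:E * (g w)%:E)%E.
    by apply/funext => w; rewrite -!EFinM -!EFinD.
  rewrite integralD//=; last 2 first.
    - apply: integrableD => //=; first apply: integrableD => //=.
      + exact: integrableZl.
      + exact: integrableZl.
    - exact: integrableZl.
  rewrite integralD//=; last 2 first.
    - apply: integrableD => //=; exact: integrableZl.
    - exact: integrableZl.
  rewrite integralD//=; last exact: integrableZl.
  rewrite !integralZl// EY EY2 integral_cst//= probability_setT mule0 !mule1 adde0.
  have M0 : 0 <= M by rewrite mulr_ge0// addr_ge0 ?sqr_ge0.
  apply: (@le_trans _ _ (1 + b%:E + M%:E * 2%:E)%E).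
    by apply: leeD => //; apply: lee_wpmul2l.
  rewrite -EFinM -!EFinD lee_fin; apply: le_trans (expR_ge1Dx _).
  rewrite -addrA lerD2l lerD2l /M.
  rewrite [(`|a| * k) ^+ 2]exprMn [(`|b| * _) ^+ 2]exprMn !real_normK ?num_real// -exprM.
  have h1 : a ^+ 2 * k ^+ 2 <= a ^+ 2 * k ^+ 4 by rewrite ler_wpM2l// sqr_ge0.
  have h2 : 0 <= b ^+ 2 * k ^+ 4 by rewrite mulr_ge0// ?sqr_ge0//; lra.
  have h3 : 0 <= a ^+ 2 * k ^+ 2 by rewrite mulr_ge0// sqr_ge0.
  rewrite [(2 * 2)%N]/=; lra.
- have g0 w : 0 <= g w by exact: expR_ge0.
  apply: (@le_trans _ _ (\int[P]_w ((expR ((`|a| * k) ^+ 2))%:E * (g w)%:E))%E).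
    apply: ge0_le_integral => //.
    + exact/measurable_EFinP.
    + by apply: measurable_funeM; exact/measurable_EFinP.
    + move=> w _; rewrite -EFinM lee_fin -expRD ler_expR -u2.
      apply: (@le_trans _ _ (`|a| * k * u w + `|b| * k ^+ 2 * u w ^+ 2)).
        have -> : `|a| * k * u w = `|a * Y w| by rewrite normrM Yw -[LHS]mulrA.
        have -> : `|b| * k ^+ 2 * u w ^+ 2 = `|b| * Y w ^+ 2.
          by rewrite -(real_normK (num_real (Y w))) Yw exprMn -[LHS]mulrA.
        by apply: lerD; [exact: ler_norm|rewrite ler_wpM2r ?sqr_ge0// ler_norm].
      have := sqr_ge0 (`|a| * k - u w / 2); have := sqr_ge0 (u w).
      by nra.
  rewrite ge0_integralZl//; last 2 first.
    + exact/measurable_EFinP.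
    + by move=> w _; rewrite lee_fin.
  apply: (@le_trans _ _ ((expR ((`|a| * k) ^+ 2))%:E * 2%:E)%E).
    by apply: lee_wpmul2l => //; rewrite lee_fin expR_ge0.
  have h2 : 2 <= expR 1 :> R by have := expR_ge1Dx (1 : R); lra.
  apply: (@le_trans _ _ ((expR ((`|a| * k) ^+ 2 + 1))%:E)).
    by rewrite -EFinM lee_fin expRD ler_wpM2l// expR_ge0.
  rewrite lee_fin ler_expR exprMn real_normK ?num_real//.
  have h3 : 1/16 <= a ^+ 2 * k ^+ 2.
    rewrite -(real_normK (num_real a)) -exprMn.
    rewrite (_ : 1/16 = (1/4) ^+ 2 :> R); last by field.
    by apply: lerXn2r; rewrite ?nnegrE; lra.
  have h4 : a ^+ 2 * k ^+ 2 <= a ^+ 2 * k ^+ 4 by rewrite ler_wpM2l// sqr_ge0.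
  have h5 : 0 <= b ^+ 2 * k ^+ 4 by rewrite mulr_ge0// ?sqr_ge0//; lra.
  lra.
Qed.

End OneDim.

(** * The Hanson-Wright inequality *)

Lemma measurable_sum_seq {R : realType} {d} {T : measurableType d} (I : eqType)
    (D : set T) (s : seq I) (h : I -> T -> R) :
  (forall i, i \in s -> measurable_fun D (h i)) ->
  measurable_fun D (fun x => \sum_(i <- s) h i x).
Proof.
elim: s => [|i s IH] mh.
  by under eq_fun do rewrite big_nil; exact: measurable_cst.
under eq_fun do rewrite big_cons; apply: measurable_funD.
  by apply: mh; rewrite mem_head.
by apply: IH => j js; apply: mh; rewrite inE js orbT.
Qed.

Section QuadraticForms.
Context {R : realType} {I : eqType}.
Implicit Types (S : I -> I -> R) (J : seq I) (x s : I -> R).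

(** Forms are restricted to a sequence of indices rather than stored as matrices, so that
    integrating out a coordinate is a step of list induction. *)
Definition quad S J x := \sum_(i <- J) \sum_(j <- J) S i j * (x i * x j).

Definition sqnorm J x := \sum_(i <- J) x i ^+ 2.

Definition lin s J x := \sum_(j <- J) s j * x j.

Lemma sqnorm_ge0 J x : 0 <= sqnorm J x.
Proof. by apply: sumr_ge0 => i _; exact: sqr_ge0. Qed.

Lemma quad_cons S i J x : (forall j k, S j k = S k j) ->
  quad S (i :: J) x = S i i * x i ^+ 2 + 2 * x i * lin (S i) J x + quad S J x.
Proof.
move=> Ssym; rewrite /quad big_cons big_cons.
under [X in _ + X = _]eq_bigr do rewrite big_cons.
rewrite big_split /=.
have -> : \sum_(j <- J) S j i * (x j * x i) = x i * lin (S i) J x.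
  by rewrite /lin mulr_sumr; apply: eq_bigr => j _; rewrite (Ssym j i); ring.
have -> : \sum_(j <- J) S i j * (x i * x j) = x i * lin (S i) J x.
  by rewrite /lin mulr_sumr; apply: eq_bigr => j _; ring.
by ring.
Qed.

Lemma quad_rank1 S s (c : R) J x :
  quad (fun j k => S j k + c * (s j * s k)) J x = quad S J x + c * lin s J x ^+ 2.
Proof.
rewrite expr2 {1}/lin mulr_suml mulr_sumr -big_split; apply: eq_bigr => j _ /=.
rewrite /lin mulr_sumr mulr_sumr -big_split; apply: eq_bigr => k _ /=.
by ring.
Qed.

Lemma eq_quad S J x y : {in J, x =1 y} -> quad S J x = quad S J y.
Proof.
move=> xy; rewrite /quad big_seq [RHS]big_seq; apply: eq_bigr => i iJ.
rewrite big_seq [RHS]big_seq; apply: eq_bigr => j jJ.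
by rewrite !xy.
Qed.

Lemma eq_lin s J x y : {in J, x =1 y} -> lin s J x = lin s J y.
Proof.
by move=> xy; rewrite /lin big_seq [RHS]big_seq; apply: eq_bigr => i iJ; rewrite xy.
Qed.

Lemma eq_sqnorm J x y : {in J, x =1 y} -> sqnorm J x = sqnorm J y.
Proof.
by move=> xy; rewrite /sqnorm big_seq [RHS]big_seq; apply: eq_bigr => i iJ; rewrite xy.
Qed.

(* Minimizing the form over the coordinate [i] is a Schur complement; the test
   value [c * lin (S i) J x] replaces the exact minimizer. *)
Lemma quad_schur S (kap c : R) i J : (forall j k, S j k = S k j) ->
  i \notin J -> 0 <= c -> 2 * c * kap <= 1 -> - kap <= S i i ->
  (forall x, quad S (i :: J) x <= kap * sqnorm (i :: J) x) ->
  forall x, quad (fun j k => S j k + c * (S i j * S i k)) J x <= kap * sqnorm J x.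
Proof.
move=> Ssym iJ c0 ck Sii hS x; rewrite quad_rank1.
pose y j := if j == i then c * lin (S i) J x else x j.
have xy : {in J, x =1 y}.
  by move=> j jJ; rewrite /y; case: eqP => // ji; move: iJ; rewrite -ji jJ.
have := hS y; rewrite quad_cons// /sqnorm big_cons -/(sqnorm J y).
rewrite -/(sqnorm J x) -(eq_quad _ xy) -(eq_lin _ xy) -(eq_sqnorm xy).
rewrite /y eqxx; set l := lin _ _ _; set q := quad _ _ _ => h.
have : (c * l) ^+ 2 * (kap - S i i) <= c * l ^+ 2.
  have -> : (c * l) ^+ 2 * (kap - S i i) = (c * l ^+ 2) * (c * (kap - S i i)) by ring.
  rewrite -[leRHS]mulr1 ler_wpM2l ?(mulr_ge0 c0 (sqr_ge0 l))//.
  have : c * (- S i i) <= c * kap by rewrite ler_wpM2l//; lra.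
  by lra.
have -> : (c * l) ^+ 2 * (kap - S i i) = kap * (c * l) ^+ 2 - S i i * (c * l) ^+ 2 by ring.
have : 2 * (c * l) * l = 2 * (c * l ^+ 2) by ring.
by lra.
Qed.

End QuadraticForms.

Section HansonWright.
Context {R : realType} {dT : measure_display} {T : measurableType dT}.
Variables (P : probability T R) (I : eqType) (X : I -> T -> R).
Hypothesis mX : forall i, measurable_fun setT (X i).
Hypothesis indX : mutually_independent P X.
Variables (C kap : R).
Hypothesis C0 : 0 <= C.
Hypothesis Ckap : 8 * C * kap <= 1.
Hypothesis mgfX : forall i a b, `|b| <= kap ->
  (\int[P]_w (expR (a * X i w + b * X i w ^+ 2))%:E <=
     (expR (b + C * (a ^+ 2 + b ^+ 2)))%:E)%E.

Lemma measurable_quad {d} {T' : measurableType d} (Y : I -> T' -> R) S J :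
  (forall i, i \in J -> measurable_fun setT (Y i)) ->
  measurable_fun setT (fun w => quad S J (Y^~ w)).
Proof.
move=> mY; apply: measurable_sum_seq => i iJ; apply: measurable_sum_seq => j jJ.
apply: measurable_funM => //; apply: measurable_funM; exact: mY.
Qed.

Lemma measurable_lin {d} {T' : measurableType d} (Y : I -> T' -> R) s J :
  (forall i, i \in J -> measurable_fun setT (Y i)) ->
  measurable_fun setT (fun w => lin s J (Y^~ w)).
Proof.
by move=> mY; apply: measurable_sum_seq => i iJ; apply: measurable_funM => //; exact: mY.
Qed.

(** Given the other coordinates, the form is [a X_i + b X_i^2] plus a constant, with
    [a = 2 lin (S i) J] and [b = S i i]; the term [C a^2] of [mgfX] is the rank-one perturbation.
    The upper bound on the form survives by [quad_schur]. The lower bound is asked of the diagonal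
    only, where the perturbation is nonnegative. *)
Theorem hanson_wright_mgf (J : seq I) (S : I -> I -> R) : uniq J ->
  (forall j k, S j k = S k j) ->
  (forall x, quad S J x <= kap * sqnorm J x) ->
  (forall i, i \in J -> - kap <= S i i) ->
  (\int[P]_w (expR (quad S J (X^~ w)))%:E <=
   (expR (\sum_(i <- J) S i i +
          4 * C * \sum_(i <- J) \sum_(j <- J) S i j ^+ 2))%:E)%E.
Proof.
elim: J S => [|i J IH] S uJ Ssym hS hd.
  rewrite !big_nil mulr0 addr0.
  under eq_integral do rewrite /quad big_nil.
  by rewrite integral_cst//= probability_setT mule1.
have /andP[iJ uJ'] := uJ.
have hi := hd i (mem_head _ _).
have hi2 : S i i <= kap.
  (* The form at the indicator of [i] is the diagonal entry. *)
  pose y j : R := (j == i)%:R.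
  have y0 : {in J, y =1 fun=> 0}.
    by move=> j jJ; rewrite /y; case: eqP => // ji; move: iJ; rewrite -ji jJ.
  have := hS y; rewrite quad_cons// /sqnorm big_cons -/(sqnorm J y).
  rewrite (eq_quad _ y0) (eq_lin _ y0) (eq_sqnorm y0) /y eqxx.
  rewrite /quad /lin /sqnorm big1; last by move=> j _; rewrite mulr0.
  rewrite big1; last by move=> j _; rewrite big1// => k _; rewrite !mulr0.
  rewrite big1; last by move=> j _; rewrite expr0n.
  by rewrite expr1n; lra.
have Si : `|S i i| <= kap by rewrite ler_norml hi hi2.
pose S' j k := S j k + 4 * C * (S i j * S i k).
(* The integrand with the block [J] and the coordinate [i] as separate arguments. *)
pose f (p : g_sigma_algebraType (cylinder X J) * R) : \bar R :=
  (expR (quad S J (X^~ p.1)) *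
   expR (2 * lin (S i) J (X^~ p.1) * p.2 + S i i * p.2 ^+ 2))%:E.
have mXJ j : j \in J -> measurable_fun setT
    (fun p : (g_sigma_algebraType (cylinder X J) * R)%type => X j p.1).
  move=> jJ.
  exact: (measurableT_comp (measurable_fun_cylinder (X := X) jJ) measurable_fst).
have mf : measurable_fun setT f.
  apply/measurable_EFinP; apply: measurable_funM.
    apply: measurableT_comp => //.
    exact: measurable_quad mXJ.
  apply: measurableT_comp => //; apply: measurable_funD; apply: measurable_funM => //.
    apply: measurable_funM => //.
    exact: measurable_lin mXJ.
  exact: measurable_funX.
have -> : (\int[P]_w (expR (quad S (i :: J) (X^~ w)))%:E =
           \int[P]_w f (w, X i w))%E.
  apply: eq_integral => w _; rewrite /f/= -expRD quad_cons//; congr (expR _)%:E.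
  by ring.
have f0 p : (0 <= f p)%E by rewrite lee_fin mulr_ge0// expR_ge0.
rewrite integral_indep//.
apply: (@le_trans _ _ (\int[P]_w
  ((expR (S i i + C * S i i ^+ 2))%:E * (expR (quad S' J (X^~ w)))%:E))%E).
  apply: ge0_le_integral => //.
  - by move=> w _; apply: integral_ge0 => v _; rewrite lee_fin mulr_ge0// expR_ge0.
  - exact: (measurable_integral_section (X := X) P mX i mf f0).
  - apply: measurable_funeM; apply/measurable_EFinP; apply: measurableT_comp => //.
    exact: measurable_quad.
  - move=> w _; rewrite /f/=.
    under eq_integral do rewrite EFinM.
    rewrite ge0_integralZl//.
    + apply: (@le_trans _ _ ((expR (quad S J (X^~ w)))%:E *
       (expR (S i i + C * ((2 * lin (S i) J (X^~ w)) ^+ 2 + S i i ^+ 2)))%:E)%E).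
        by apply: lee_wpmul2l; [rewrite lee_fin expR_ge0|exact: mgfX].
      rewrite -!EFinM lee_fin -!expRD ler_expR quad_rank1.
      by rewrite le_eqVlt; apply/orP; left; apply/eqP; ring.
    + apply/measurable_EFinP; apply: measurableT_comp => //.
      apply: measurable_funD; apply: measurable_funM => //; exact: measurable_funX.
rewrite ge0_integralZl//; last first.
  by apply/measurable_EFinP; apply: measurableT_comp => //; exact: measurable_quad.
have hS' : forall x, quad S' J x <= kap * sqnorm J x.
  have c0 : 0 <= 4 * C by rewrite mulr_ge0.
  have ck : 2 * (4 * C) * kap <= 1 by rewrite mulrA -natrM.
  exact: quad_schur.
have S'sym j k : S' j k = S' k j by rewrite /S' Ssym [S i j * _]mulrC.
apply: (@le_trans _ _ ((expR (S i i + C * S i i ^+ 2))%:E *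
   (expR (\sum_(j <- J) S' j j +
      4 * C * \sum_(j <- J) \sum_(k <- J) S' j k ^+ 2))%:E)%E).
  apply: lee_wpmul2l; first by rewrite lee_fin expR_ge0.
  apply: IH => // j jJ.
  have := hd j; rewrite inE jJ orbT => /(_ isT) h.
  by apply: (le_trans h); rewrite lerDl -expr2 mulr_ge0 ?sqr_ge0// mulr_ge0.
rewrite -EFinM lee_fin -expRD ler_expR.
have trS' : \sum_(j <- J) S' j j = \sum_(j <- J) S j j + 4 * C * sqnorm J (S i).
  by rewrite big_split /= -mulr_sumr; congr (_ + _ * _); apply: eq_bigr => j _; rewrite expr2.
have FS : \sum_(j <- i :: J) \sum_(k <- i :: J) S j k ^+ 2 =
    S i i ^+ 2 + 2 * sqnorm J (S i) + \sum_(j <- J) \sum_(k <- J) S j k ^+ 2.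
  rewrite !big_cons; under [X in _ + X = _]eq_bigr do rewrite big_cons.
  rewrite big_split /=.
  have -> : \sum_(j <- J) S j i ^+ 2 = sqnorm J (S i).
    by apply: eq_bigr => j _; rewrite Ssym.
  by rewrite /sqnorm; ring.
(* A difference of squares: the increment of the Frobenius norm is a sum of two forms evaluated at
   the row [S i], so the one-sided bound [kap] controls it. *)
have FS' : \sum_(j <- J) \sum_(k <- J) S' j k ^+ 2 =
    \sum_(j <- J) \sum_(k <- J) S j k ^+ 2 +
    4 * C * (quad S J (S i) + quad S' J (S i)).
  rewrite /quad -big_split mulr_sumr -big_split; apply: eq_bigr => j _ /=.
  rewrite -big_split mulr_sumr -big_split; apply: eq_bigr => k _ /=.
  by rewrite /S'; ring.
have hq : quad S J (S i) <= quad S' J (S i).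
  by rewrite quad_rank1 lerDl mulr_ge0 ?sqr_ge0// mulr_ge0.
have hq' := hS' (S i).
have n0 := sqnorm_ge0 J (S i).
have hF : \sum_(j <- J) \sum_(k <- J) S' j k ^+ 2 <=
    \sum_(j <- J) \sum_(k <- J) S j k ^+ 2 + sqnorm J (S i).
  rewrite FS' lerD2l.
  apply: (@le_trans _ _ (4 * C * (2 * (kap * sqnorm J (S i))))).
    by rewrite ler_wpM2l ?mulr_ge0//; lra.
  have -> : 4 * C * (2 * (kap * sqnorm J (S i))) = (8 * C * kap) * sqnorm J (S i) by ring.
  by rewrite -[leRHS]mul1r ler_wpM2r.
rewrite trS' FS big_cons.
have := ler_wpM2l (mulr_ge0 (ler0n R 4) C0) hF.
have := mulr_ge0 C0 (sqr_ge0 (S i i)).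
by lra.
Qed.

End HansonWright.

(** Lagrange's identity. *)
Lemma cauchy_schwarz_sum {R : realFieldType} (I : Type) (r : seq I) (a b : I -> R) :
  (\sum_(i <- r) a i * b i) ^+ 2 <=
  (\sum_(i <- r) a i ^+ 2) * (\sum_(i <- r) b i ^+ 2).
Proof.
have h : 0 <= \sum_(i <- r) \sum_(j <- r) (a i * b j - a j * b i) ^+ 2.
  by apply: sumr_ge0 => i _; apply: sumr_ge0 => j _; exact: sqr_ge0.
suff e : \sum_(i <- r) \sum_(j <- r) (a i * b j - a j * b i) ^+ 2 =
    2 * ((\sum_(i <- r) a i ^+ 2) * (\sum_(i <- r) b i ^+ 2)) -
    2 * (\sum_(i <- r) a i * b i) ^+ 2 by rewrite e in h; lra.
have e1 : (\sum_(i <- r) a i ^+ 2) * (\sum_(i <- r) b i ^+ 2) =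
    \sum_(i <- r) \sum_(j <- r) a i ^+ 2 * b j ^+ 2.
  by rewrite mulr_suml; apply: eq_bigr => i _; rewrite mulr_sumr.
have e2 : (\sum_(i <- r) a i ^+ 2) * (\sum_(i <- r) b i ^+ 2) =
    \sum_(i <- r) \sum_(j <- r) a j ^+ 2 * b i ^+ 2.
  by rewrite e1 exchange_big.
have e3 : (\sum_(i <- r) a i * b i) ^+ 2 =
    \sum_(i <- r) \sum_(j <- r) a i * b i * (a j * b j).
  by rewrite expr2 mulr_suml; apply: eq_bigr => i _; rewrite mulr_sumr.
rewrite mulr_natl mulr2n {1}e1 e2 e3 mulr_sumr -big_split -sumrB.
apply: eq_bigr => i _ /=; rewrite mulr_sumr -big_split -sumrB.
by apply: eq_bigr => j _ /=; ring.
Qed.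

(** * Bilinear forms in the noise and their symmetric matrices *)

Section Bilinear.
Context {R : realType} {I : eqType}.
Variables (J : seq I) (m : nat).
Implicit Types (P Q : 'I_m -> I -> R) (x : I -> R).

Definition indicator_at (i : I) : I -> R := fun j => (j == i)%:R.

Lemma lin_delta (s : I -> R) i : uniq J -> i \in J -> lin s J (indicator_at i) = s i.
Proof.
move=> uJ iJ; rewrite /lin (bigD1_seq i)//= /indicator_at eqxx mulr1 big1 ?addr0//.
by move=> j /negPf ->; rewrite mulr0.
Qed.

Lemma sqnorm_delta i : uniq J -> i \in J -> sqnorm J (indicator_at i) = 1.
Proof.
move=> uJ iJ; rewrite /sqnorm (bigD1_seq i)//= /indicator_at eqxx expr1n big1 ?addr0//.
by move=> j /negPf ->; rewrite expr0n.
Qed.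

Definition bilin P Q x := \sum_(s < m) lin (P s) J x * lin (Q s) J x.

(** The symmetric part of [lam P^T Q], with [P] and [Q] read as matrices with [m] rows. *)
Definition sym_form (lam : R) P Q : I -> I -> R := fun i j =>
  lam / 2 * (\sum_(s < m) P s i * Q s j + \sum_(s < m) P s j * Q s i).

Lemma quad_sym_form lam P Q x : quad (sym_form lam P Q) J x = lam * bilin P Q x.
Proof.
have e : quad (fun i j => \sum_(s < m) P s i * Q s j) J x = bilin P Q x.
  rewrite /quad /bilin.
  under eq_bigr => i _ do (under eq_bigr => j _ do rewrite mulr_suml).
  under eq_bigr => i _ do rewrite exchange_big.
  rewrite exchange_big; apply: eq_bigr => s _ /=.
  rewrite /lin mulr_suml; apply: eq_bigr => i _.
  by rewrite mulr_sumr; apply: eq_bigr => j _; ring.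
have -> : lam * bilin P Q x = lam / 2 * (bilin P Q x + bilin P Q x) by field.
rewrite -{1}e -e /quad [X in _ * (_ + X)]exchange_big -big_split mulr_sumr.
apply: eq_bigr => i _ /=; rewrite -big_split mulr_sumr.
by apply: eq_bigr => j _ /=; rewrite /sym_form; ring.
Qed.

(** An operator and its transpose have the same norm: the hypothesis is tested at [y = P^T q] and
    one factor [|y|^2] is cancelled. *)
Lemma adjoint_bound P (p2 : R) (q : 'I_m -> R) : 0 <= p2 ->
  (forall x, \sum_(s < m) lin (P s) J x ^+ 2 <= p2 * sqnorm J x) ->
  \sum_(i <- J) (\sum_(s < m) P s i * q s) ^+ 2 <= p2 * \sum_(s < m) q s ^+ 2.
Proof.
move=> p20 hP; pose y i := \sum_(s < m) P s i * q s.
rewrite -/(sqnorm J y).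
have e : sqnorm J y = \sum_(s < m) lin (P s) J y * q s.
  rewrite /sqnorm; under eq_bigr do rewrite expr2 {2}/y mulr_sumr.
  rewrite exchange_big; apply: eq_bigr => s _ /=.
  by rewrite /lin mulr_suml; apply: eq_bigr => i _; ring.
have h : sqnorm J y ^+ 2 <= (p2 * sqnorm J y) * \sum_(s < m) q s ^+ 2.
  rewrite {1}e; apply: (le_trans (cauchy_schwarz_sum _ _ _)).
  by rewrite ler_wpM2r// sumr_ge0// => s _; exact: sqr_ge0.
have [y0|y0] := leP (sqnorm J y) 0.
  by apply: (le_trans y0); rewrite mulr_ge0// sumr_ge0// => s _; exact: sqr_ge0.
rewrite -(ler_pM2l y0) -expr2; apply: (le_trans h).
by rewrite le_eqVlt; apply/orP; left; apply/eqP; ring.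
Qed.

Lemma bilin_sqr_bound P Q (p2 q2 : R) x : 0 <= p2 ->
  (forall x, \sum_(s < m) lin (P s) J x ^+ 2 <= p2 * sqnorm J x) ->
  (forall x, \sum_(s < m) lin (Q s) J x ^+ 2 <= q2 * sqnorm J x) ->
  bilin P Q x ^+ 2 <= p2 * q2 * sqnorm J x ^+ 2.
Proof.
move=> p20 hP hQ; apply: (le_trans (cauchy_schwarz_sum _ _ _)).
have -> : p2 * q2 * sqnorm J x ^+ 2 = (p2 * sqnorm J x) * (q2 * sqnorm J x) by ring.
by apply: ler_pM; rewrite // sumr_ge0// => s _; exact: sqr_ge0.
Qed.

(** The columns of [P^T Q] are bounded by [adjoint_bound], so its Frobenius norm is at most the
    operator norm of [P] times the Frobenius norm of [Q]; symmetrizing does not increase it. *)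
Lemma frobenius_sym_form lam P Q (p2 : R) : 0 <= p2 ->
  (forall x, \sum_(s < m) lin (P s) J x ^+ 2 <= p2 * sqnorm J x) ->
  \sum_(s < m) sqnorm J (Q s) <= 1 ->
  \sum_(i <- J) \sum_(j <- J) sym_form lam P Q i j ^+ 2 <= lam ^+ 2 * p2.
Proof.
move=> p20 hP hQ.
pose M i j := \sum_(s < m) P s i * Q s j.
have hM : \sum_(i <- J) \sum_(j <- J) M i j ^+ 2 <= p2.
  rewrite exchange_big.
  apply: (@le_trans _ _ (\sum_(j <- J) p2 * \sum_(s < m) Q s j ^+ 2)).
    by apply: ler_sum => j _; exact: adjoint_bound.
  rewrite -mulr_sumr exchange_big -[leRHS]mulr1; exact: ler_wpM2l.
apply: (@le_trans _ _ (\sum_(i <- J) \sum_(j <- J)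
    lam ^+ 2 / 2 * (M i j ^+ 2 + M j i ^+ 2))).
  apply: ler_sum => i _; apply: ler_sum => j _.
  rewrite /sym_form -/(M i j) -/(M j i).
  have := mulr_ge0 (sqr_ge0 lam) (sqr_ge0 (M i j - M j i)).
  have -> : (lam / 2 * (M i j + M j i)) ^+ 2 =
     lam ^+ 2 / 4 * (M i j + M j i) ^+ 2 by field.
  by nra.
under eq_bigr do rewrite -mulr_sumr big_split/=.
rewrite -mulr_sumr big_split/= [X in _ + X]exchange_big/= -mulrA.
rewrite ler_wpM2l ?sqr_ge0//.
set F := \sum_(i <- J) _ in hM *; lra.
Qed.

End Bilinear.

Lemma measurable_le_set {R : realType} {d} {T : measurableType d} (f g : T -> R) :
  measurable_fun setT f -> measurable_fun setT g ->
  measurable [set w | (f w <= g w)%R].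
Proof. by move=> mf mg; rewrite -[X in measurable X]setTI; exact: measurable_fun_le. Qed.

Lemma measurable_lt_set {R : realType} {d} {T : measurableType d} (f g : T -> R) :
  measurable_fun setT f -> measurable_fun setT g ->
  measurable [set w | (f w < g w)%R].
Proof.
move=> mf mg; have -> : [set w | (f w < g w)%R] = ~` [set w | (g w <= f w)%R].
  by apply/seteqP; split => w /=; rewrite ltNge => /negP.
by apply: measurableC; exact: measurable_le_set.
Qed.

(** * Exponential tails of centred bilinear forms *)

Section Tail.
Context {R : realType} {dT : measure_display} {T : measurableType dT}.
Variables (P : probability T R) (I : eqType) (X : I -> T -> R).
Hypothesis mX : forall i, measurable_fun setT (X i).
Hypothesis indX : mutually_independent P X.
Variables (C kap : R).
Hypothesis C0 : 0 <= C.
Hypothesis kap0 : 0 <= kap.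
Hypothesis Ckap : 8 * C * kap <= 1.
Hypothesis mgfX : forall i a b, `|b| <= kap ->
  (\int[P]_w (expR (a * X i w + b * X i w ^+ 2))%:E <=
     (expR (b + C * (a ^+ 2 + b ^+ 2)))%:E)%E.
Variables (J : seq I) (m : nat) (A B : 'I_m -> I -> R) (p2 q2 : R).
Hypothesis uJ : uniq J.
Hypothesis p20 : 0 <= p2.
Hypothesis hA : forall x, \sum_(s < m) lin (A s) J x ^+ 2 <= p2 * sqnorm J x.
Hypothesis hB : forall x, \sum_(s < m) lin (B s) J x ^+ 2 <= q2 * sqnorm J x.
Hypothesis fB : \sum_(s < m) sqnorm J (B s) <= 1.

Let Z w := bilin J A B (X^~ w).
Let tr := \sum_(i <- J) \sum_(s < m) A s i * B s i.

Lemma measurable_bilin : measurable_fun setT Z.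
Proof.
apply: measurable_sum => s; apply: measurable_funM.
  by apply: measurable_lin => i _; exact: mX.
by apply: measurable_lin => i _; exact: mX.
Qed.

(** The condition on [lam] bounds the absolute value of the form. This gives the upper bound on the
    form and, at indicators, the lower bound on the diagonal. The sign of [lam] is free, which
    yields both tails. *)
Lemma bilin_mgf (lam : R) : lam ^+ 2 * (p2 * q2) <= kap ^+ 2 ->
  (\int[P]_w (expR (lam * (Z w - tr)))%:E <= (expR (4 * C * (lam ^+ 2 * p2)))%:E)%E.
Proof.
move=> hl.
have hq x : `|lam * bilin J A B x| <= kap * sqnorm J x.
  have n0 := sqnorm_ge0 J x.
  rewrite -(@ler_pXn2r _ 2)// ?nnegrE ?mulr_ge0// real_normK ?num_real//.
  rewrite !exprMn; apply: (@le_trans _ _ (lam ^+ 2 * (p2 * q2 * sqnorm J x ^+ 2))).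
    by rewrite ler_wpM2l ?sqr_ge0//; exact: bilin_sqr_bound.
  by rewrite mulrA ler_wpM2r ?sqr_ge0.
pose S := sym_form lam A B.
have Sii i : S i i = lam * \sum_(s < m) A s i * B s i by rewrite /S /sym_form; field.
have hw : (\int[P]_w (expR (quad S J (X^~ w)))%:E <=
   (expR (\sum_(i <- J) S i i +
          4 * C * \sum_(i <- J) \sum_(j <- J) S i j ^+ 2))%:E)%E.
  apply: (hanson_wright_mgf mX indX C0 Ckap mgfX uJ).
  - by move=> j k; rewrite /S /sym_form addrC.
  - by move=> x; rewrite quad_sym_form; exact: le_trans (ler_norm _) (hq x).
  - move=> i iJ; have := hq (indicator_at i); rewrite sqnorm_delta// mulr1 ler_norml.
    move=> /andP[+ _] => /le_trans; apply; rewrite Sii /bilin.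
    by under eq_bigr do rewrite !lin_delta//.
have -> : (\int[P]_w (expR (lam * (Z w - tr)))%:E =
   \int[P]_w ((expR (- (lam * tr)))%:E * (expR (quad S J (X^~ w)))%:E))%E.
  apply: eq_integral => w _; rewrite -EFinM -expRD quad_sym_form.
  by congr (expR _)%:E; rewrite /Z; ring.
rewrite ge0_integralZl//; last first.
  apply/measurable_EFinP; apply: measurableT_comp => //.
  by apply: measurable_quad => i _; exact: mX.
apply: (@le_trans _ _ ((expR (- (lam * tr)))%:E *
  (expR (\sum_(i <- J) S i i +
          4 * C * \sum_(i <- J) \sum_(j <- J) S i j ^+ 2))%:E)%E).
  by apply: lee_wpmul2l; rewrite // lee_fin expR_ge0.
rewrite -EFinM -expRD lee_fin ler_expR.
have -> : \sum_(i <- J) S i i = lam * tr.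
  by rewrite /tr mulr_sumr; apply: eq_bigr => i _; rewrite Sii.
rewrite addKr ler_wpM2l ?mulr_ge0//; exact: frobenius_sym_form.
Qed.

Lemma exp_markov (Y : T -> R) (M r : R) : measurable_fun setT Y ->
  (\int[P]_w (expR (Y w))%:E <= (expR M)%:E)%E ->
  (P [set w | r <= Y w]%R <= (expR (M - r))%:E)%E.
Proof.
move=> mY hY.
have mS : measurable [set w | (r <= Y w)%R].
  exact: measurable_le_set.
have h : ((expR r)%:E * P [set w | (r <= Y w)%R] <= \int[P]_w (expR (Y w))%:E)%E.
  have -> : (P [set w | (r <= Y w)%R] = \int[P]_w (\1_[set w | (r <= Y w)%R] w)%:E)%E.
    by rewrite integral_indic// setIT.
  rewrite -ge0_integralZl//.
  - apply: ge0_le_integral => //.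
    + by apply: measurable_funeM; exact/measurable_EFinP.
    + by apply/measurable_EFinP; exact: measurableT_comp.
    + move=> w _; rewrite -EFinM lee_fin indicE.
      have [|_] := boolP (w \in _); last by rewrite mulr0 expR_ge0.
      by rewrite inE /= mulr1 ler_expR.
  - exact/measurable_EFinP.
have := le_trans h hY.
rewrite -(@fineK _ (P _)) ?fin_num_measure// -EFinM !lee_fin => h2.
by rewrite expRD expRN ler_pdivlMr ?expR_gt0// mulrC.
Qed.

Lemma bilin_tail (lam r : R) : 0 <= lam -> lam ^+ 2 * (p2 * q2) <= kap ^+ 2 ->
  (P [set w | (r < `|Z w - tr|)%R] <= (2 * expR (4 * C * (lam ^+ 2 * p2) - lam * r))%:E)%E.
Proof.
move=> l0 hl; have mZ := measurable_bilin.
have mL (l : R) : measurable_fun setT (fun w => l * (Z w - tr)).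
  by apply: measurable_funM => //; exact: measurable_funB.
have mS (l s : R) : measurable [set w | (s <= l * (Z w - tr))%R].
  exact: measurable_le_set.
have h1 := exp_markov (lam * r) (mL lam) (bilin_mgf hl).
have hl' : (- lam) ^+ 2 * (p2 * q2) <= kap ^+ 2 by rewrite sqrrN.
have h2 := exp_markov (lam * r) (mL (- lam)) (bilin_mgf hl').
rewrite sqrrN in h2.
rewrite mulr_natl mulr2n EFinD; apply: le_trans (leeD h1 h2).
apply: (@le_trans _ _ (P ([set w | (lam * r <= lam * (Z w - tr))%R] `|`
    [set w | (lam * r <= - lam * (Z w - tr))%R]))).
  apply: le_measure; rewrite ?inE//=.
  - apply: measurable_lt_set => //; apply: measurableT_comp => //.
    exact: measurable_funB.
  - exact: measurableU.
  - move=> w /=; have [h|h] := leP 0 (Z w - tr).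
      by rewrite ger0_norm// => hr; left; rewrite /= ler_wpM2l// ltW.
    by rewrite ltr0_norm// => hr; right; rewrite /= mulNr -mulrN ler_wpM2l// ltW.
exact: measureU2.
Qed.

End Tail.

(** * Euclidean geometry and operator norms *)

Section Euclid.
Context {R : realType}.

Definition dotv n (x y : 'cV[R]_n) : R := \sum_(i < n) x i 0 * y i 0.

Lemma dotvE n (x y : 'cV[R]_n) : dotv x y = (x^T *m y) 0 0.
Proof. by rewrite mxE; apply: eq_bigr => i _; rewrite mxE. Qed.

Lemma dotvC n (x y : 'cV[R]_n) : dotv x y = dotv y x.
Proof. by apply: eq_bigr => i _; rewrite mulrC. Qed.

Lemma dotvDl n (x y z : 'cV[R]_n) : dotv (x + y) z = dotv x z + dotv y z.
Proof. by rewrite -big_split; apply: eq_bigr => i _; rewrite mxE mulrDl. Qed.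

Lemma dotvDr n (x y z : 'cV[R]_n) : dotv z (x + y) = dotv z x + dotv z y.
Proof. by rewrite dotvC dotvDl !(dotvC z). Qed.

Lemma dotvZl n a (x z : 'cV[R]_n) : dotv (a *: x) z = a * dotv x z.
Proof. by rewrite mulr_sumr; apply: eq_bigr => i _; rewrite mxE mulrA. Qed.

Lemma dotvZr n a (x z : 'cV[R]_n) : dotv z (a *: x) = a * dotv z x.
Proof. by rewrite dotvC dotvZl dotvC. Qed.

Lemma dotvNl n (x z : 'cV[R]_n) : dotv (- x) z = - dotv x z.
Proof. by rewrite -scaleN1r dotvZl mulN1r. Qed.

Lemma dotvBl n (x y z : 'cV[R]_n) : dotv (x - y) z = dotv x z - dotv y z.
Proof. by rewrite dotvDl dotvNl. Qed.

Lemma dotvBr n (x y z : 'cV[R]_n) : dotv z (x - y) = dotv z x - dotv z y.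
Proof. by rewrite dotvC dotvBl !(dotvC z). Qed.

Lemma dot0v n (z : 'cV[R]_n) : dotv 0 z = 0.
Proof. by rewrite -(scale0r 0) dotvZl mul0r. Qed.

Lemma dotv0 n (z : 'cV[R]_n) : dotv z 0 = 0.
Proof. by rewrite dotvC dot0v. Qed.

Lemma dotv_suml n (I : Type) (r : seq I) (f : I -> 'cV[R]_n) z :
  dotv (\sum_(i <- r) f i) z = \sum_(i <- r) dotv (f i) z.
Proof.
by apply: (big_morph (fun x => dotv x z)); [move=> x y; exact: dotvDl|exact: dot0v].
Qed.

Lemma dotv_sumr n (I : Type) (r : seq I) (f : I -> 'cV[R]_n) z :
  dotv z (\sum_(i <- r) f i) = \sum_(i <- r) dotv z (f i).
Proof. by rewrite dotvC dotv_suml; apply: eq_bigr => i _; rewrite dotvC. Qed.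

Lemma dotv_mulmx m n (M : 'M[R]_(m, n)) x y : dotv x (M *m y) = dotv (M^T *m x) y.
Proof. by rewrite !dotvE trmx_mul trmxK mulmxA. Qed.

Lemma dotv_outer n (x y u v : 'cV[R]_n) : dotv u (x *m y^T *m v) = dotv u x * dotv y v.
Proof.
have -> : x *m y^T *m v = dotv y v *: x.
  rewrite -mulmxA [y^T *m v]mx11_scalar -dotvE mul_mx_scalar.
  by [].
by rewrite dotvZr mulrC.
Qed.

Lemma dotv_ge0 n (x : 'cV[R]_n) : 0 <= dotv x x.
Proof. by apply: sumr_ge0 => i _; rewrite -expr2 sqr_ge0. Qed.

Lemma dotv_eq0 n (x : 'cV[R]_n) : dotv x x = 0 -> x = 0.
Proof.
move=> h; apply/matrixP => i j; rewrite (ord1 j) mxE.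
have /(_ i isT) : forall i, true -> x i 0 * x i 0 = 0.
  by apply: psumr_eq0P h => k _; rewrite -expr2 sqr_ge0.
by move/eqP; rewrite mulf_eq0 orbb => /eqP.
Qed.

Lemma enorm_ge0 n (x : 'cV[R]_n) : 0 <= enorm x.
Proof. exact: sqrtr_ge0. Qed.

Lemma enorm_sqr n (x : 'cV[R]_n) : enorm x ^+ 2 = dotv x x.
Proof.
rewrite sqr_sqrtr; first by apply: eq_bigr => i _; rewrite expr2.
by apply: sumr_ge0 => i _; exact: sqr_ge0.
Qed.

Lemma ler_enorm n (x : 'cV[R]_n) c : 0 <= c -> (enorm x <= c) = (dotv x x <= c ^+ 2).
Proof. by move=> c0; rewrite -enorm_sqr ler_sqr// nnegrE// enorm_ge0. Qed.

Lemma enormZ n a (x : 'cV[R]_n) : enorm (a *: x) = `|a| * enorm x.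
Proof.
apply/eqP; rewrite -(@eqrXn2 _ 2)// ?mulr_ge0 ?enorm_ge0//; apply/eqP.
by rewrite exprMn !enorm_sqr real_normK ?num_real// dotvZl dotvZr mulrA.
Qed.

Lemma enormN n (x : 'cV[R]_n) : enorm (- x) = enorm x.
Proof. by rewrite -scaleN1r enormZ normrN1 mul1r. Qed.

Lemma enorm0 n : enorm (0 : 'cV[R]_n) = 0.
Proof. by rewrite -(scale0r 0) enormZ normr0 mul0r. Qed.

Lemma enorm_eq0 n (x : 'cV[R]_n) : enorm x = 0 -> x = 0.
Proof. by move=> h; apply: dotv_eq0; rewrite -enorm_sqr h expr0n. Qed.

Lemma cauchy_schwarz n (x y : 'cV[R]_n) : `|dotv x y| <= enorm x * enorm y.
Proof.
rewrite -(@ler_pXn2r _ 2)// ?nnegrE ?mulr_ge0 ?enorm_ge0//.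
rewrite real_normK ?num_real// exprMn !enorm_sqr.
apply: (le_trans (cauchy_schwarz_sum _ _ _)).
by rewrite le_eqVlt; apply/orP; left; apply/eqP; congr (_ * _); apply: eq_bigr => i _;
  rewrite expr2.
Qed.

Lemma dotv_le n (x y : 'cV[R]_n) : dotv x y <= enorm x * enorm y.
Proof. exact: le_trans (ler_norm _) (cauchy_schwarz x y). Qed.

Lemma ler_enormD n (x y : 'cV[R]_n) : enorm (x + y) <= enorm x + enorm y.
Proof.
rewrite ler_enorm ?addr_ge0 ?enorm_ge0// dotvDl !dotvDr (dotvC y x).
rewrite sqrrD !enorm_sqr; have := dotv_le x y; lra.
Qed.

(** A crude bound that supplies finiteness of suprema and other qualitative facts; it does not enter
    the final constants. *)
Definition frob m n (M : 'M[R]_(m, n)) := Num.sqrt (\sum_i \sum_j M i j ^+ 2).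

Lemma enorm_frob m n (M : 'M[R]_(m, n)) x : enorm (M *m x) <= frob M * enorm x.
Proof.
have F0 : 0 <= \sum_i \sum_j M i j ^+ 2.
  by apply: sumr_ge0 => i _; apply: sumr_ge0 => j _; exact: sqr_ge0.
rewrite ler_enorm ?mulr_ge0 ?sqrtr_ge0 ?enorm_ge0//.
rewrite exprMn sqr_sqrtr// enorm_sqr /dotv mulr_suml.
apply: ler_sum => i _; rewrite -expr2 mxE.
apply: (le_trans (cauchy_schwarz_sum _ _ _)).
by rewrite ler_wpM2l//; apply: sumr_ge0 => j _; exact: sqr_ge0.
Qed.

Lemma opnorm_set_ub m n (M : 'M[R]_(m, n)) :
  ubound [set enorm (M *m x) | x in [set x : 'cV[R]_n | enorm x <= 1]] (frob M).
Proof.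
move=> _ [x x1 <-]; apply: (le_trans (enorm_frob M x)).
by rewrite -[leRHS]mulr1 ler_wpM2l// sqrtr_ge0.
Qed.

Lemma opnorm_has_sup m n (M : 'M[R]_(m, n)) :
  has_sup [set enorm (M *m x) | x in [set x : 'cV[R]_n | enorm x <= 1]].
Proof.
split; last by exists (frob M); exact: opnorm_set_ub.
by exists (enorm (M *m 0)); exists 0 => //=; rewrite enorm0.
Qed.

Lemma opnorm_ge0 m n (M : 'M[R]_(m, n)) : 0 <= opnorm M.
Proof.
apply: (@le_trans _ _ (enorm (M *m 0))); first exact: enorm_ge0.
by apply: sup_upper_bound; [exact: opnorm_has_sup|exists 0 => //=; rewrite enorm0].
Qed.

Lemma enorm_opnorm m n (M : 'M[R]_(m, n)) x : enorm (M *m x) <= opnorm M * enorm x.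
Proof.
have [x0|x0] := eqVneq (enorm x) 0.
  by rewrite (enorm_eq0 x0) mulmx0 !enorm0 mulr0.
have xp : 0 < enorm x by rewrite lt_def x0 enorm_ge0.
rewrite -ler_pdivrMr// mulrC.
have -> : (enorm x)^-1 * enorm (M *m x) = enorm (M *m ((enorm x)^-1 *: x)).
  by rewrite -scalemxAr enormZ gtr0_norm ?invr_gt0.
apply: sup_upper_bound; [exact: opnorm_has_sup|exists ((enorm x)^-1 *: x) => //=].
by rewrite enormZ gtr0_norm ?invr_gt0// mulVf.
Qed.

Lemma opnorm_le m n (M : 'M[R]_(m, n)) c : 0 <= c ->
  (forall x, enorm (M *m x) <= c * enorm x) -> opnorm M <= c.
Proof.
move=> c0 h; apply: ge_sup; first by have [] := opnorm_has_sup M.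
move=> _ [x x1 <-]; apply: (le_trans (h x)).
by rewrite -[leRHS]mulr1 ler_wpM2l.
Qed.

Lemma opnorm_gt m n (M : 'M[R]_(m, n)) eps : eps < opnorm M ->
  exists2 x, enorm x <= 1 & eps < enorm (M *m x).
Proof.
move=> h; have [_ [x x1 <-] hx] := sup_gt (opnorm_has_sup M).1 h.
by exists x.
Qed.

End Euclid.

(** * Nets of the unit ball *)

Section Net.
Context {R : realType}.

Lemma geometric_half_le (n : nat) : \sum_(k < n) (2^-1 : R) ^+ k <= 2.
Proof.
suff -> : \sum_(k < n) (2^-1 : R) ^+ k = 2 - 2 * 2^-1 ^+ n.
  by rewrite gerBl mulr_ge0// exprn_ge0// invr_ge0.
elim: n => [|n IH]; first by rewrite big_ord0 expr0; lra.
by rewrite big_ord_recr/= IH exprS; lra.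
Qed.

(* Markov's inequality for the counting measure weighted by [2 ^ - sum k_i],
   which factorizes over the coordinates. *)
Lemma card_lattice_points (d N M : nat) :
  (#|[set f : {ffun 'I_d -> bool * 'I_N} | (\sum_i (f i).2 <= M)%N]%SET|%:R : R)
    <= 2 ^+ M * 4 ^+ d.
Proof.
rewrite -sum1_card natr_sum.
apply: (@le_trans _ _ (\sum_(f : {ffun 'I_d -> bool * 'I_N})
    2 ^+ M * \prod_i (2^-1 : R) ^+ (f i).2)).
  rewrite big_mkcond/=; apply: ler_sum => f _; rewrite inE.
  have p0 : 0 <= 2 ^+ M * \prod_i (2^-1 : R) ^+ (f i).2.
    by rewrite mulr_ge0 ?exprn_ge0// prodr_ge0// => i _; rewrite exprn_ge0// invr_ge0.
  case: ifP => // h.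
  rewrite prodrXr exprVn -(@ler_pM2r _ (2 ^+ (\sum_i (f i).2))) ?exprn_gt0//.
  rewrite mul1r -mulrA mulVf ?mulr1 ?expf_neq0//.
  by rewrite ler_weXn2l// ler1n.
rewrite -mulr_sumr ler_wpM2l ?exprn_ge0//.
rewrite -(bigA_distr_bigA (fun (i : 'I_d) (p : bool * 'I_N) => (2^-1 : R) ^+ p.2)).
rewrite -[in leRHS](card_ord d) -prodr_const.
apply: ler_prod => i _; apply/andP; split.
  by apply: sumr_ge0 => p _; rewrite exprn_ge0// invr_ge0.
(* Two signs, each with a geometric sum at most 2, give the factor 4 per coordinate. *)
rewrite -(pair_big xpredT xpredT (fun (b : bool) (k : 'I_N) => (2^-1 : R) ^+ k))/=.
rewrite big_bool/=; have := geometric_half_le N; lra.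
Qed.

(** The net consists of the points of a grid of mesh [1 / q], [q = 4 sqrt d], that lie in the ball.
    Rounding each coordinate towards zero stays in the ball and costs at most [sqrt d / q = 1/4];
    the sign is stored apart for this reason. The integer coordinates satisfy
    [sum k_i <= sum k_i^2 <= 16 d], and there are at most [2^(16 d) 4^d] of them. *)
Lemma unit_ball_net (d : nat) : (0 < d)%N -> exists s : seq 'cV[R]_d,
  [/\ (size s)%:R <= (2 : R) ^+ (18 * d),
      {in s, forall v, enorm v <= 1} &
      forall z, enorm z <= 1 -> exists2 v, v \in s & enorm (z - v) <= 1 / 4].
Proof.
move=> d0; pose N := (16 * d).+1.
pose q : R := 4 * Num.sqrt d%:R.
have q2 : q ^+ 2 = 16 * d%:R by rewrite exprMn sqr_sqrtr ?ler0n//; ring.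
have q0 : 0 < q by rewrite mulr_gt0// sqrtr_gt0 ltr0n.
pose vec (f : {ffun 'I_d -> bool * 'I_N}) : 'cV[R]_d :=
  \col_i ((-1) ^+ (f i).1 * (f i).2%:R / q).
have vecE f : dotv (vec f) (vec f) = (\sum_i (f i).2 ^ 2)%N%:R / q ^+ 2.
  rewrite natr_sum mulr_suml; apply: eq_bigr => i _.
  rewrite -expr2 mxE expr_div_n exprMn sqrr_sign mul1r natrX//.
pose G := [set f : {ffun 'I_d -> bool * 'I_N} | (\sum_i (f i).2 ^ 2 <= 16 * d)%N]%SET.
exists [seq vec f | f in G]; split.
- rewrite size_map -cardE.
  have -> : (2 : R) ^+ (18 * d) = 2 ^+ (16 * d) * 4 ^+ d.
    have -> : (4 : R) = 2 ^+ 2 by rewrite expr2 -natrM.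
    by rewrite -exprM -exprD -mulnDl.
  apply: le_trans (card_lattice_points d N (16 * d)).
  rewrite ler_nat; apply: subset_leq_card; apply/fintype.subsetP => f; rewrite !inE.
  apply: leq_trans; apply: leq_sum => i _.
  by case: (val _) => // k; rewrite leq_pmulr.
- move=> v /mapP[f]; rewrite mem_enum inE => hf ->.
  rewrite ler_enorm// expr1n vecE q2 ler_pdivrMr ?mulr_gt0 ?ltr0n// mul1r.
  by rewrite -natrM ler_nat.
- move=> z z1.
  pose k i := Num.truncn (`|z i 0| * q).
  have zq i : 0 <= `|z i 0| * q by rewrite mulr_ge0// ltW.
  have k1 i : (k i)%:R <= `|z i 0| * q by rewrite truncn_le.
  have k2 i : `|z i 0| * q < (k i).+1%:R by exact: truncnS_gt.
  have hk : (\sum_i k i ^ 2 <= 16 * d)%N.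
    rewrite -(ler_nat R) natr_sum natrM -q2.
    rewrite ler_enorm ?ler01// expr1n in z1.
    apply: (@le_trans _ _ (\sum_i (z i 0 * z i 0 * q ^+ 2))).
      apply: ler_sum => i _; rewrite natrX.
      apply: (@le_trans _ _ ((`|z i 0| * q) ^+ 2)).
        by rewrite ler_sqr ?nnegrE.
      by rewrite exprMn real_normK ?num_real// expr2.
    rewrite -mulr_suml -/(dotv z z) -[leRHS]mul1r ler_wpM2r//.
    exact: sqr_ge0.
  have kN i : (k i < N)%N.
    rewrite ltnS; apply: leq_trans hk; rewrite (bigD1 i)//=.
    apply: leq_trans (leq_addr _ _).
    by case: (k i) => // n; rewrite leq_pmulr.
  pose f : {ffun 'I_d -> bool * 'I_N} := [ffun i => (z i 0 < 0, Ordinal (kN i))].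
  exists (vec f).
    apply: map_f; rewrite mem_enum inE.
    by under eq_bigr do rewrite ffunE.
  rewrite ler_enorm; last lra.
  apply: (@le_trans _ _ (\sum_(i < d) q^-1 ^+ 2)).
    apply: ler_sum => i _; rewrite -expr2 !mxE ffunE/=.
    have -> : z i 0 - (-1) ^+ (z i 0 < 0)%R * (k i)%:R / q =
       (-1) ^+ (z i 0 < 0)%R * ((`|z i 0| * q - (k i)%:R) / q).
      rewrite mulrBl mulfK ?gt_eqF// mulrBr mulrA; congr (_ - _).
      by rewrite {1}(realEsign (num_real (z i 0))).
    have a0 : 0 <= (`|z i 0| * q - (k i)%:R) / q.
      by rewrite divr_ge0 ?subr_ge0 ?k1// ltW.
    have a1 : (`|z i 0| * q - (k i)%:R) / q <= q^-1.
      rewrite ler_pdivrMr// mulVf ?gt_eqF//.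
      by have := k2 i; rewrite -natr1; lra.
    rewrite exprMn sqrr_sign mul1r lerXn2r// nnegrE invr_ge0 ltW//.
  rewrite sumr_const card_ord.
  have -> : q^-1 ^+ 2 *+ d = 1 / 16.
    rewrite -[LHS]mulr_natl exprVn q2; field.
    by rewrite pnatr_eq0 -lt0n.
  lra.
Qed.

(** Replacing both arguments by net points shows that the supremum [M] satisfies
    [M <= r + M/4 + M/4]; being finite, it is at most [2 r]. *)
Lemma bilinear_net (d : nat) (s : seq 'cV[R]_d) (D : 'M[R]_d) (r : R) :
  {in s, forall v, enorm v <= 1} ->
  (forall z, enorm z <= 1 -> exists2 v, v \in s & enorm (z - v) <= 1 / 4) ->
  {in s &, forall v w, `|dotv v (D *m w)| <= r} ->
  forall x y, `|dotv x (D *m y)| <= 2 * r * (enorm x * enorm y).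
Proof.
move=> s1 snet hs.
pose E := [set a : R | exists x y, [/\ enorm x <= 1, enorm y <= 1 & a = `|dotv x (D *m y)|]].
have hE : has_sup E.
  split; first by exists `|dotv 0 (D *m 0)|; exists 0, 0; rewrite enorm0.
  exists (frob D) => _ [x [y [x1 y1 ->]]].
  apply: (le_trans (cauchy_schwarz _ _)); rewrite -[leRHS]mul1r.
  apply: ler_pM; rewrite ?enorm_ge0//.
  by apply: (le_trans (enorm_frob D y)); rewrite -[leRHS]mulr1 ler_wpM2l ?sqrtr_ge0.
pose M := sup E.
have hM x y : `|dotv x (D *m y)| <= M * (enorm x * enorm y).
  have [x0|x0] := eqVneq (enorm x) 0.
    by rewrite (enorm_eq0 x0) dot0v enorm0 mul0r mulr0 normr0.
  have [y0|y0] := eqVneq (enorm y) 0.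
    by rewrite (enorm_eq0 y0) mulmx0 dotv0 enorm0 !mulr0 normr0.
  have xp : 0 < enorm x by rewrite lt_def x0 enorm_ge0.
  have yp : 0 < enorm y by rewrite lt_def y0 enorm_ge0.
  rewrite -ler_pdivrMr ?mulr_gt0//.
  have -> : `|dotv x (D *m y)| / (enorm x * enorm y) =
     `|dotv ((enorm x)^-1 *: x) (D *m ((enorm y)^-1 *: y))|.
    have nx : `|(enorm x)^-1| = (enorm x)^-1 by rewrite gtr0_norm ?invr_gt0.
    have ny : `|(enorm y)^-1| = (enorm y)^-1 by rewrite gtr0_norm ?invr_gt0.
    rewrite -scalemxAr dotvZl dotvZr !normrM nx ny.
    by rewrite invfM; ring.
    apply: (sup_upper_bound hE); exists ((enorm x)^-1 *: x), ((enorm y)^-1 *: y); split => //.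
    by rewrite enormZ gtr0_norm ?invr_gt0// mulVf.
  by rewrite enormZ gtr0_norm ?invr_gt0// mulVf.
have M0 : 0 <= M.
  apply: (@le_trans _ _ `|dotv 0 (D *m 0)|) => //.
  by apply: (sup_upper_bound hE); exists 0, 0; rewrite enorm0.
have Mr : M <= r + M / 2.
  apply: ge_sup; first by have [] := hE.
  move=> _ [x [y [x1 y1 ->]]].
  have [v vs xv] := snet x x1; have [w ws yw] := snet y y1.
  have -> : dotv x (D *m y) =
      dotv v (D *m w) + dotv (x - v) (D *m y) + dotv v (D *m (y - w)).
    by rewrite dotvBl mulmxBr dotvBr; ring.
  apply: (le_trans (ler_normD _ _)).
  have h1 := hs v w vs ws.
  have h2 : `|dotv (x - v) (D *m y)| <= M * (1/4 * 1).
    apply: (le_trans (hM _ _)); rewrite ler_wpM2l//.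
    by apply: ler_pM; rewrite ?enorm_ge0.
  have h3 : `|dotv v (D *m (y - w))| <= M * (1 * (1/4)).
    apply: (le_trans (hM _ _)); rewrite ler_wpM2l//.
    by apply: ler_pM; rewrite ?enorm_ge0// s1.
  have := ler_normD (dotv v (D *m w)) (dotv (x - v) (D *m y)).
  lra.
move=> x y; apply: (le_trans (hM x y)); rewrite ler_wpM2r ?mulr_ge0 ?enorm_ge0//.
lra.
Qed.

End Net.

(** * Rayleigh quotients and reduction to the identity *)

Section Spectral.
Context {R : realType}.

Definition psd n (M : 'M[R]_n) := M^T = M /\ forall x, 0 <= dotv x (M *m x).

(* Nonnegativity of the form at [x - t M x] with [t = 1 / f]. *)
Lemma psd_sqr_le n (M : 'M[R]_n) x : psd M ->
  dotv (M *m x) (M *m x) <= (frob M + 1) * dotv x (M *m x).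
Proof.
move=> [Msym M0]; pose f := frob M + 1.
have f0 : 0 < f by rewrite ltr_wpDl// sqrtr_ge0.
pose y := M *m x.
have := M0 (x - f^-1 *: y).
have yM : dotv y (M *m x) = dotv x (M *m y) by rewrite [RHS]dotv_mulmx Msym dotvC.
rewrite mulmxBr -scalemxAr !dotvBl !dotvBr !dotvZl !dotvZr -yM -/y.
have h : dotv y (M *m y) <= f * dotv y y.
  apply: (le_trans (dotv_le _ _)).
  apply: (@le_trans _ _ (enorm y * (frob M * enorm y))).
    by rewrite ler_wpM2l ?enorm_ge0// enorm_frob.
  rewrite -enorm_sqr /f; have := sqr_ge0 (enorm y); lra.
set a := dotv x y; set b := dotv y y in h *; set c := dotv y (M *m y) in h *.
move=> h2.
have e : f^-1 * f = 1 by rewrite mulVf ?gt_eqF.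
have fi0 : 0 < f^-1 by rewrite invr_gt0.
have h3 : f^-1 * c <= b by rewrite -[leRHS]mul1r -e -mulrA ler_wpM2l// ltW.
have h4 : f^-1 * (f^-1 * c) <= f^-1 * b by rewrite ler_wpM2l// ltW.
have h5 : f^-1 * b <= a by lra.
by have := ler_wpM2l (ltW f0) h5; rewrite mulrA mulfV ?gt_eqF// mul1r.
Qed.

Lemma unitmx_kernel n (M : 'M[R]_n) : M \notin unitmx ->
  exists2 v : 'rV_n, v != 0 & v *m M = 0.
Proof.
rewrite -row_free_unit -kermx_eq0 => /rowV0Pn[v vk v0].
by exists v => //; apply/sub_kermxP.
Qed.

(** The infimum [a] of the form on the unit sphere is an eigenvalue, shown without compactness. If
    [N = M - a] were invertible, [psd_sqr_le] would give [|z|^2 <= F <z, N z>], and the infimum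
    would be at least [a + 1/F]. *)
Lemma lambda_min_rayleigh n (M : 'M[R]_n) x : psd M ->
  lambda_min M * dotv x x <= dotv x (M *m x).
Proof.
move=> [Msym M0].
have [x0|x0] := eqVneq (dotv x x) 0.
  by rewrite (dotv_eq0 x0) !dot0v mulr0.
pose S := [set dotv y (M *m y) | y in [set y : 'cV[R]_n | dotv y y = 1]].
have scale (z : 'cV[R]_n) : dotv z z != 0 -> exists2 y, dotv y y = 1 &
    dotv z (M *m z) = dotv z z * dotv y (M *m y).
  move=> z0; have zp : 0 < dotv z z by rewrite lt_def z0 dotv_ge0.
  pose c := (Num.sqrt (dotv z z))^-1.
  have cc : c * c * dotv z z = 1.
    by rewrite /c -invfM -expr2 sqr_sqrtr ?dotv_ge0// mulVf.
  exists (c *: z); rewrite -?scalemxAr !dotvZl !dotvZr; first by rewrite mulrA.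
  by rewrite -[LHS]mul1r -cc; ring.
have S0 : S !=set0 by have [y y1 _] := scale x x0; exists (dotv y (M *m y)), y.
have Slb : has_lbound S by exists 0 => _ [y _ <-]; exact: M0.
pose a := inf S.
have aS y : dotv y y = 1 -> a <= dotv y (M *m y).
  by move=> y1; apply: ge_inf => //; exists y.
have aM z : a * dotv z z <= dotv z (M *m z).
  have [z0|z0] := eqVneq (dotv z z) 0; first by rewrite (dotv_eq0 z0) !dot0v mulr0.
  have [y y1 ->] := scale z z0; rewrite mulrC ler_wpM2l ?dotv_ge0//; exact: aS.
suff : lambda_min M <= a.
  by move=> h; apply: (le_trans _ (aM x)); rewrite ler_wpM2r// dotv_ge0.
pose N := M - a%:M.
have NE z : dotv z (N *m z) = dotv z (M *m z) - a * dotv z z.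
  by rewrite mulmxBl mul_scalar_mx dotvBr dotvZr.
have Npsd : psd N.
  split; first by rewrite linearB/= Msym tr_scalar_mx.
  by move=> z; rewrite NE subr_ge0.
have [Nu|Nu] := boolP (N \in unitmx); last first.
  have [v v0 vN] := unitmx_kernel Nu.
  apply: ge_inf; last first.
    rewrite /=; apply/eigenvalueP; exists v => //.
    by move/eqP: vN; rewrite mulmxBr mul_mx_scalar subr_eq0 => /eqP.
  (* The eigenvalues of [M] are bounded below by 0, as the infimum in [lambda_min] requires. *)
  exists 0 => b /= /eigenvalueP[u uM u0].
  have : 0 <= b * dotv u^T u^T.
    have := M0 u^T; rewrite -[M in M *m _]trmxK -trmx_mul Msym uM.
    by rewrite linearZ/= dotvZr.
  rewrite pmulr_lge0// lt_def dotv_ge0 andbT.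
  by apply: contra u0 => /eqP/dotv_eq0 uT; rewrite -[u]trmxK uT trmx0.
exfalso.
pose F := frob (invmx N) ^+ 2 * (frob N + 1).
have hF z : dotv z z <= F * dotv z (N *m z).
  have := enorm_frob (invmx N) (N *m z); rewrite mulKmx// => h.
  have : enorm z ^+ 2 <= (frob (invmx N) * enorm (N *m z)) ^+ 2.
    by rewrite lerXn2r// ?nnegrE ?mulr_ge0 ?enorm_ge0 ?sqrtr_ge0.
  rewrite exprMn !enorm_sqr => /le_trans; apply.
  by rewrite /F -mulrA ler_wpM2l ?sqr_ge0// psd_sqr_le.
have F0 : 0 < F.
  have [y y1 _] := scale x x0; have := hF y; rewrite y1.
  rewrite lt_def mulr_ge0 ?sqr_ge0 ?addr_ge0 ?sqrtr_ge0// andbT.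
  by apply: contraTneq => ->; rewrite mul0r ler10.
have : a + F^-1 <= a.
  apply: lb_le_inf => // _ [y y1 <-].
  have := hF y; rewrite y1 NE y1 mulr1 -ler_pdivrMl// mulr1; lra.
by rewrite gerDl leNgt invr_gt0 F0.
Qed.

(** Gram-Schmidt for the inner product of [M]. With fewer than [n] columns in [W], the rank of [M W]
    leaves a nonzero vector orthogonal to all of them. *)
Lemma congruence_to_identity n (M : 'M[R]_n) : M^T = M ->
  (forall x, x != 0 -> 0 < dotv x (M *m x)) ->
  exists W : 'M[R]_n, W^T *m M *m W = 1%:M.
Proof.
move=> Msym Mpos.
suff H r : (r <= n)%N -> exists W : 'M[R]_(n, r), W^T *m M *m W = 1%:M by exact: (H n).
elim: r => [_|r IH rn]; first by exists 0; apply/matrixP => -[].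
have [W hW] := IH (ltnW rn).
have : kermx (M *m W) != 0.
  rewrite -mxrank_eq0 mxrank_ker -lt0n subn_gt0.
  exact: leq_ltn_trans (rank_leq_col _) rn.
move/rowV0Pn => [v /sub_kermxP vk v0].
have x0 : v^T != 0 by rewrite -(inj_eq trmx_inj) trmxK trmx0.
have q0 := Mpos _ x0.
pose c := (Num.sqrt (dotv v^T (M *m v^T)))^-1.
pose x := c *: v^T.
have xx : x^T *m M *m x = 1%:M.
  rewrite [LHS]mx11_scalar -mulmxA -dotvE -scalemxAr dotvZl dotvZr mulrA -invfM.
  by rewrite -expr2 sqr_sqrtr ?ltW// mulVf ?gt_eqF.
have xW : x^T *m M *m W = 0.
  by rewrite linearZ/= trmxK -!scalemxAl -mulmxA vk scaler0.
have Wx : W^T *m M *m x = 0.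
  by apply: trmx_inj; rewrite !trmx_mul trmxK Msym mulmxA xW trmx0.
have h : (row_mx x W)^T *m M *m row_mx x W = 1%:M.
  by rewrite tr_row_mx mul_col_mx mul_col_row xx xW Wx hW -scalar_mx_block.
by exists (row_mx x W).
Qed.

End Spectral.

(** * The block Toeplitz operator from noise to states *)

Section Toeplitz.
Context {R : realType} (d t : nat) (A : 'M[R]_d).

Lemma enorm_mxcol (y : 'I_t -> 'cV[R]_d) :
  enorm (\mxcol_(j < t) y j) ^+ 2 = \sum_j dotv (y j) (y j).
Proof.
rewrite enorm_sqr dotvE tr_mxcol mul_mxrow_mxcol summxE.
by apply: eq_bigr => j _; rewrite dotvE.
Qed.

Lemma toeplitz_bound (y : 'I_t -> 'cV[R]_d) :
  \sum_(i < t) dotv (\sum_(j < t | (j <= i)%N) A ^+ (i - j) *m y j)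
                    (\sum_(j < t | (j <= i)%N) A ^+ (i - j) *m y j)
  <= opnorm (toeplitz_Gamma A t) ^+ 2 * \sum_j dotv (y j) (y j).
Proof.
have e : toeplitz_Gamma A t *m \mxcol_(j < t) y j =
    \mxcol_(i < t) \sum_(j < t | (j <= i)%N) A ^+ (i - j) *m y j.
  rewrite /toeplitz_Gamma mul_mxblock_mxrow; apply: eq_mxcol => i.
  rewrite [RHS]big_mkcond/=; apply: eq_bigr => j _.
  by case: ifP => // _; rewrite mul0mx.
rewrite -!enorm_mxcol -e -exprMn.
by rewrite lerXn2r ?nnegrE ?mulr_ge0 ?opnorm_ge0 ?enorm_ge0// enorm_opnorm.
Qed.

End Toeplitz.

(** * Measurability of the estimator *)

Section Pinv.
Context {R : realType}.

Lemma gram_unitmx k l (B : 'M[R]_(k, l)) : row_free B -> B *m B^T \in unitmx.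
Proof.
move=> fB; rewrite -row_free_unit -kermx_eq0; apply/eqP/row_matrixP => i.
rewrite row0; set v := row i _.
have vB : v *m (B *m B^T) = 0 by rewrite -row_mul mulmx_ker row0.
have h : v *m B = 0.
  apply: trmx_inj; rewrite trmx0; apply: dotv_eq0.
  by rewrite dotvE trmxK trmx_mul mulmxA -[v *m B *m _]mulmxA vB mul0mx mxE.
by apply: (row_free_inj fB); rewrite mul0mx.
Qed.

(** The explicit solution is [L^T (L L^T)^-1 (C^T C)^-1 C^T]. *)
Lemma penrose_rank_factorization m r n (C : 'M[R]_(m, r)) (L : 'M[R]_(r, n)) :
  row_free C^T -> row_free L -> exists X, penrose (C *m L) X.
Proof.
move=> /gram_unitmx + /gram_unitmx uL; rewrite trmxK => uC.
pose Li := invmx (L *m L^T); pose Ci := invmx (C^T *m C).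
have LLi : L *m L^T *m Li = 1%:M by rewrite mulmxV.
have CiC : Ci *m C^T *m C = 1%:M by rewrite -mulmxA mulVmx.
have LiT : Li^T = Li by rewrite trmx_inv trmx_mul trmxK.
have CiT : Ci^T = Ci by rewrite trmx_inv trmx_mul trmxK.
pose X := L^T *m Li *m (Ci *m C^T).
have MX : C *m L *m X = C *m (Ci *m C^T).
  by rewrite /X mulmxA -(mulmxA C) (mulmxA L) LLi mulmx1.
have XM : X *m (C *m L) = L^T *m Li *m L.
  by rewrite /X mulmxA -(mulmxA _ _ C) CiC mulmx1.
exists X; split.
- by rewrite MX -[C *m _ *m _]mulmxA [_ *m (C *m L)]mulmxA CiC mul1mx.
- by rewrite XM /X mulmxA -(mulmxA _ L) (mulmxA L) LLi mulmx1.
- by rewrite MX !trmx_mul trmxK CiT mulmxA.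
- by rewrite XM !trmx_mul trmxK LiT mulmxA.
Qed.

(** [pinv] is a choice with default value 0, so existence is what gives it the Penrose equations. *)
Lemma penrose_exists m n (M : 'M[R]_(m, n)) : exists X, penrose M X.
Proof.
have hC : row_free (col_base M)^T.
  by rewrite /row_free mxrank_tr; have := col_base_full M; rewrite /row_full.
by have := penrose_rank_factorization hC (row_base_free M); rewrite mulmx_base.
Qed.

Lemma pinv_penrose m n (M : 'M[R]_(m, n)) : penrose M (pinv M).
Proof. apply: (xgetPex 0); exact: penrose_exists. Qed.

Lemma pinv_unit n (M : 'M[R]_n) : M \in unitmx -> pinv M = invmx M.
Proof.
move=> uM; have [h _ _ _] := pinv_penrose M.
apply: (can_inj (mulKmx uM)); apply: (can_inj (mulmxK uM)).
by rewrite h mulmxV// mul1mx.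
Qed.

Lemma entry_le_enorm n (x : 'cV[R]_n) i : `|x i 0| <= enorm x.
Proof.
rewrite -(@ler_pXn2r _ 2)// ?nnegrE ?enorm_ge0// real_normK ?num_real// enorm_sqr.
rewrite /dotv (bigD1 i)//= expr2 lerDl.
by apply: sumr_ge0 => j _; rewrite -expr2 sqr_ge0.
Qed.

Section Tikhonov.
Variables (n : nat) (M : 'M[R]_n) (e : R).
Hypothesis e0 : 0 < e.

Let H := M^T *m M + e%:M.

Lemma tikhonov_form x : e * dotv x x <= dotv x (H *m x).
Proof.
rewrite mulmxDl mul_scalar_mx dotvDr dotvZr lerDr -mulmxA dotv_mulmx trmxK.
exact: dotv_ge0.
Qed.

Lemma tikhonov_unit : H \in unitmx.
Proof.
apply/negPn/negP => /unitmx_kernel[v v0 vH].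
have Hs : H^T = H by rewrite linearD/= trmx_mul trmxK tr_scalar_mx.
have Hv : H *m v^T = 0 by apply: trmx_inj; rewrite trmx_mul trmxK Hs vH trmx0.
have := tikhonov_form v^T; rewrite Hv dotv0.
rewrite pmulr_rle0// => h.
have /dotv_eq0 vT : dotv v^T v^T = 0 by apply/eqP; rewrite eq_le h dotv_ge0.
by move: v0; rewrite -[v]trmxK vT trmx0 eqxx.
Qed.

(** With [u = H^-1 y], [e |u|^2 <= <u, H u> = <u, y>]; one factor [|u|] cancels. *)
Lemma tikhonov_contraction y : enorm (e *: (invmx H *m y)) <= enorm y.
Proof.
set u := invmx H *m y.
have Hu : H *m u = y by rewrite mulKVmx// tikhonov_unit.
rewrite enormZ gtr0_norm//.
have [u0|u0] := eqVneq (enorm u) 0; first by rewrite u0 mulr0 enorm_ge0.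
have up : 0 < enorm u by rewrite lt_def u0 enorm_ge0.
rewrite -(ler_pM2l up); apply: (le_trans _ (dotv_le u y)).
by rewrite -[X in dotv u X]Hu; apply: le_trans (tikhonov_form u); rewrite -enorm_sqr mulrCA expr2.
Qed.

End Tikhonov.

(** Writing the pseudo-inverse as [X = N Z] with [N = M^T M], the error is
    [e H^-1 X = e (Z - e H^-1 Z)], and [tikhonov_contraction] bounds the bracket uniformly in
    [e]. *)
Lemma pinv_tikhonov n (M : 'M[R]_n) i j : exists c, forall e, 0 < e ->
  `|pinv M i j - (invmx (M^T *m M + e%:M) *m M^T) i j| <= e * c.
Proof.
have [MXM XMX MXs XMs] := pinv_penrose M; set X := pinv M in MXM XMX MXs XMs *.
pose Z := X *m X^T *m X; pose N := M^T *m M.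
have NX : N *m X = M^T by rewrite -mulmxA -[M *m X]MXs -trmx_mul MXM.
have XN : X = N *m Z.
  rewrite /Z /N -[X *m X^T *m X]mulmxA 2!mulmxA -/N NX.
  by rewrite -trmx_mul XMs XMX.
exists (2 * enorm (col j Z)) => e e0; pose H := N + e%:M.
have uH : H \in unitmx by exact: tikhonov_unit.
have HN : invmx H *m N = 1%:M - e *: invmx H.
  rewrite -[N](addrK e%:M) -/H mulmxBr mulVmx// mul_mx_scalar//.
have <- : (X - invmx H *m M^T) i j = X i j - (invmx H *m M^T) i j.
  by rewrite [LHS]mxE [X in _ + X]mxE.
have -> : X - invmx H *m M^T = e *: (Z - e *: (invmx H *m Z)).
  rewrite -NX mulmxA HN mulmxBl mul1mx subKr -scalemxAl {1}XN mulmxA HN.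
  by rewrite mulmxBl mul1mx scalemxAl.
rewrite mxE normrM gtr0_norm// ler_wpM2l ?(ltW e0)//.
pose z := col j Z.
have -> : (Z - e *: (invmx H *m Z)) i j = z i 0 - (e *: (invmx H *m z)) i 0.
  rewrite !mxE; congr (_ - _ * _); apply: eq_bigr => k _.
  by rewrite !mxE.
apply: (le_trans (ler_normB _ _)).
have := entry_le_enorm z i; have := entry_le_enorm (e *: (invmx H *m z)) i.
have := tikhonov_contraction M e0 z.
by rewrite -/N -/H -/z; lra.
Qed.

End Pinv.

(** * Random matrices, their pseudo-inverses and operator norms *)

Section RandomMatrices.
Context {R : realType} {d : measure_display} {T : measurableType d}.

Definition measurable_mx m n (M : T -> 'M[R]_(m, n)) :=
  forall i j, measurable_fun setT (fun w => M w i j).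

Lemma measurable_mx_cst m n (M : 'M[R]_(m, n)) : measurable_mx (fun=> M).
Proof. by move=> i j; exact: measurable_cst. Qed.

Lemma measurable_mxD m n (M N : T -> 'M[R]_(m, n)) :
  measurable_mx M -> measurable_mx N -> measurable_mx (fun w => M w + N w).
Proof.
by move=> mM mN i j; under eq_fun do rewrite mxE; exact: measurable_funD.
Qed.

Lemma measurable_mxB m n (M N : T -> 'M[R]_(m, n)) :
  measurable_mx M -> measurable_mx N -> measurable_mx (fun w => M w - N w).
Proof.
by move=> mM mN i j; under eq_fun do rewrite !mxE; exact: measurable_funB.
Qed.

Lemma measurable_mx_sum m n (I : Type) (s : seq I) (M : I -> T -> 'M[R]_(m, n)) :
  (forall k, measurable_mx (M k)) -> measurable_mx (fun w => \sum_(k <- s) M k w).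
Proof.
move=> mM i j; under eq_fun do rewrite summxE.
by apply: measurable_sum => k; exact: mM.
Qed.

Lemma measurable_mx_tr m n (M : T -> 'M[R]_(m, n)) :
  measurable_mx M -> measurable_mx (fun w => (M w)^T).
Proof. by move=> mM i j; under eq_fun do rewrite mxE; exact: mM. Qed.

Lemma measurable_mxM m n p (M : T -> 'M[R]_(m, n)) (N : T -> 'M[R]_(n, p)) :
  measurable_mx M -> measurable_mx N -> measurable_mx (fun w => M w *m N w).
Proof.
move=> mM mN i j; under eq_fun do rewrite mxE.
by apply: measurable_sum => k; apply: measurable_funM; [exact: mM|exact: mN].
Qed.

Lemma measurable_det n (M : T -> 'M[R]_n) : measurable_mx M ->
  measurable_fun setT (fun w => \det (M w)).
Proof.
move=> mM; apply: measurable_sum => s; apply: measurable_funM => //.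
by apply: measurable_prod => i _; exact: mM.
Qed.

Lemma measurable_invr (f : T -> R) : measurable_fun setT f ->
  measurable_fun setT (fun w => (f w)^-1).
Proof.
move=> mf.
(* The formula is also valid at 0, where the inverse is 0 by convention. *)
have -> : (fun w => (f w)^-1) = (fun w => f w * expR (- ln (f w ^+ 2))).
  apply/funext => w; have [->|f0] := eqVneq (f w) 0; first by rewrite invr0 mul0r.
  rewrite expRN lnK; last by rewrite posrE exprn_even_gt0.
  by rewrite expr2 invfM mulVKf.
apply: measurable_funM => //; apply: measurableT_comp => //.
apply: measurableT_comp => //; apply: (measurableT_comp (@measurable_ln R)).
exact: measurable_funX.
Qed.

Lemma measurable_mx_inv n (M : T -> 'M[R]_n) : measurable_mx M -> (forall w, M w \in unitmx) ->
  measurable_mx (fun w => invmx (M w)).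
Proof.
move=> mM uM i j; under eq_fun do rewrite /invmx uM !mxE.
apply: measurable_funM; first exact/measurable_invr/measurable_det.
apply: measurable_funM => //; apply: measurable_det => k l.
by under eq_fun do rewrite !mxE; exact: mM.
Qed.

Lemma measurable_mx_pinv n (M : T -> 'M[R]_n) :
  measurable_mx M -> measurable_mx (fun w => pinv (M w)).
Proof.
move=> mM i j.
pose h k w := (invmx ((M w)^T *m M w + (harmonic k)%:M) *m (M w)^T) i j.
apply: (@measurable_fun_cvg _ _ _ _ h).
  move=> k; apply: (measurable_mxM _ (measurable_mx_tr mM)); apply: measurable_mx_inv => [|w].
    exact: measurable_mxD (measurable_mxM (measurable_mx_tr mM) mM) (measurable_mx_cst _).
  by apply: tikhonov_unit; exact: harmonic_gt0.
move=> w _; have [c hc] := pinv_tikhonov (M w) i j.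
set x := pinv (M w) i j in hc *.
apply: (@squeeze_cvgr _ _ _ _ (fun k => x - harmonic k * c) (fun k => x + harmonic k * c)).
- apply: nearW => k; have := hc _ (harmonic_gt0 k); rewrite -/(h k w) ler_norml.
  by move=> /andP[h1 h2]; apply/andP; split; lra.
- rewrite -[X in _ --> X]subr0 -[X in x - X](mul0r c).
  by apply: cvgB; [exact: cvg_cst|apply: cvgMl; exact: cvg_harmonic].
- rewrite -[X in _ --> X]addr0 -[X in x + X](mul0r c).
  by apply: cvgD; [exact: cvg_cst|apply: cvgMl; exact: cvg_harmonic].
Qed.

(** The event is a countable union over rational vectors. The homogeneous condition
    [eps |q| < |M q|] spares keeping the rational approximations in the unit ball. *)
Lemma measurable_opnorm_gt n (M : T -> 'M[R]_n) (eps : R) : measurable_mx M -> 0 < eps ->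
  measurable [set w | eps < opnorm (M w)].
Proof.
move=> mM e0.
have -> : [set w | eps < opnorm (M w)] =
  \bigcup_(q in [set: 'cV[rat]_n]) [set w | eps ^+ 2 * dotv (map_mx ratr q) (map_mx ratr q) <
     dotv (M w *m map_mx ratr q) (M w *m map_mx ratr q)].
  apply/seteqP; split => w /=.
    move=> /opnorm_gt[x x1 hx].
    pose F := frob (M w); have F0 : 0 <= F := sqrtr_ge0 _.
    have D0 : 0 < (F + eps) * n%:R + 1.
      by rewrite ltr_wpDl// mulr_ge0// addr_ge0// ltW.
    (* The summand 1 makes the approximation cost strictly smaller than the gap [|M x| - eps]. *)
    have [eta [eta0 etaE]] : exists eta, 0 < eta /\
        eta * ((F + eps) * n%:R + 1) = enorm (M w *m x) - eps.
      exists ((enorm (M w *m x) - eps) / ((F + eps) * n%:R + 1)); split.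
        by rewrite divr_gt0// subr_gt0.
      by rewrite divfK// gt_eqF.
    have /choice[q hq] : forall i, exists q : rat, `|x i 0 - ratr q| <= eta.
      move=> i; have [|q] := @rat_in_itvoo R (x i 0 - eta) (x i 0 + eta); first lra.
      by rewrite in_itv/= => /andP[q1 q2]; exists q; rewrite ler_norml; apply/andP; split; lra.
    exists (\col_i q i) => //=.
    set y := map_mx _ _.
    have xy : enorm (x - y) <= n%:R * eta.
      rewrite ler_enorm ?mulr_ge0 ?ler0n ?(ltW eta0)//.
      apply: (@le_trans _ _ (\sum_(i < n) eta ^+ 2)).
        apply: ler_sum => i _; rewrite -expr2 !mxE -real_normK ?num_real//.
        by rewrite lerXn2r ?nnegrE// ltW.
      rewrite sumr_const card_ord -[leLHS]mulr_natl exprMn ler_wpM2r ?sqr_ge0//.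
      by rewrite expr2 -natrM ler_nat; case: (n) => // k; rewrite leq_pmulr.
    have Mxy : enorm (M w *m x) <= F * enorm (x - y) + enorm (M w *m y).
      rewrite -{1}(subrK y x) mulmxDr; apply: (le_trans (ler_enormD _ _)).
      by rewrite lerD2r enorm_frob.
    have yx : enorm y <= 1 + enorm (x - y).
      rewrite -{1}(subKr x y); apply: (le_trans (ler_enormD _ _)).
      by rewrite enormN lerD2r.
    have h1 : (F + eps) * enorm (x - y) <= (F + eps) * (n%:R * eta).
      by rewrite ler_wpM2l// addr_ge0// ltW.
    have h2 : eps * enorm y <= eps * (1 + enorm (x - y)) by rewrite ler_wpM2l// ltW.
    have h3 : eps * enorm y < enorm (M w *m y) by lra.
    rewrite -!enorm_sqr -exprMn ltrXn2r// ?nnegrE ?mulr_ge0 ?enorm_ge0//.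
    exact: ltW.
  move=> [q _ /=]; set y := map_mx _ _; rewrite -!enorm_sqr -exprMn => h.
  have h1 : eps * enorm y < enorm (M w *m y).
    by rewrite -(@ltr_pXn2r _ 2)// nnegrE ?mulr_ge0 ?enorm_ge0// ltW.
  have h2 := lt_le_trans h1 (enorm_opnorm (M w) y).
  have [y0|y0] := eqVneq (enorm y) 0; first by rewrite y0 !mulr0 ltxx in h2.
  by rewrite ltr_pM2r// lt_def y0 enorm_ge0 in h2.
apply: countable_bigcupT_measurable; first exact: countableP.
move=> q; apply: measurable_lt_set; first exact: measurable_cst.
apply: measurable_sum => i.
by apply: measurable_funM; exact: (measurable_mxM mM (measurable_mx_cst _)).
Qed.

End RandomMatrices.

(** * The estimator as a function of the noise *)

Section Deterministic.
Context {R : realType}.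

(* With [v = V^-1 y] and [z = W^-1 v], both [`|z|^2 <= 2 <v, y>] and
   [mu `|v|^2 <= `|z|^2], whence [sqrt mu `|z| <= 2 `|y|]. *)
Lemma least_squares_error (d : nat) (A Sg V S W : 'M[R]_d) (mu r eps : R) :
  0 < mu -> 0 <= r -> 0 < eps -> 4 * r <= eps * Num.sqrt mu ->
  Sg^T = Sg -> V^T = V ->
  (forall x, mu * dotv x x <= dotv x (Sg *m x)) ->
  W^T *m Sg *m W = 1%:M ->
  (forall x y, `|dotv x (W^T *m (V - Sg) *m W *m y)| <= 2 * (1/4) * (enorm x * enorm y)) ->
  (forall x y, `|dotv x (S *m W *m y)| <= 2 * r * (enorm x * enorm y)) ->
  opnorm ((A *m V + S) *m pinv V - A) <= eps.
Proof.
move=> mu0 r0 eps0 hr Sgs Vs hmu hW hN hS.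
have [_ uW] := mulmx1_unit hW.
have adj (x y : 'cV[R]_d) : dotv (W *m x) y = dotv x (W^T *m y).
  by rewrite [RHS]dotv_mulmx trmxK.
have WSg x y : dotv (W *m x) (Sg *m (W *m y)) = dotv x y.
  by rewrite adj !mulmxA hW mul1mx.
(* In the coordinates of [W] the deviation is at most [2 * (1/4) = 1/2], which leaves [V] at least
   half of [Sg]. *)
have hV z : 1/2 * dotv z z <= dotv (W *m z) (V *m (W *m z)).
  have e : dotv z (W^T *m (V - Sg) *m W *m z) =
      dotv (W *m z) (V *m (W *m z)) - dotv z z.
    by rewrite -(WSg z z) -dotvBr -mulmxBl adj !mulmxA.
  have := hN z z; rewrite e -expr2 enorm_sqr ler_norml => /andP[h _]; lra.
have uV : V \in unitmx.
  apply/negPn/negP => /unitmx_kernel[v v0 vV].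
  have Vv : V *m v^T = 0 by apply: trmx_inj; rewrite trmx_mul trmxK Vs vV trmx0.
  have := hV (invmx W *m v^T); rewrite mulKVmx// Vv dotv0 => h.
  have /dotv_eq0 z0 : dotv (invmx W *m v^T) (invmx W *m v^T) = 0.
    by apply/eqP; rewrite eq_le dotv_ge0 andbT; lra.
  by move: v0; rewrite -[v]trmxK -(mulKVmx uW v^T) z0 mulmx0 trmx0 eqxx.
rewrite pinv_unit// mulmxDl mulmxK// addrC addKr.
apply: opnorm_le; first exact: ltW.
move=> y; pose v := invmx V *m y; pose z := invmx W *m v.
have Vv : V *m v = y by rewrite mulKVmx.
have Wz : W *m z = v by rewrite mulKVmx.
have hz : 1/2 * enorm z ^+ 2 <= enorm v * enorm y.
  rewrite enorm_sqr; apply: (le_trans (hV z)); rewrite Wz Vv; exact: dotv_le.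
have hv : mu * enorm v ^+ 2 <= enorm z ^+ 2.
  by rewrite !enorm_sqr; apply: (le_trans (hmu v)); rewrite -{1 2}Wz WSg.
pose q := Num.sqrt mu.
have q0 : 0 < q by rewrite sqrtr_gt0.
have qq : q ^+ 2 = mu by rewrite sqr_sqrtr// ltW.
have nz := enorm_ge0 z; have nv := enorm_ge0 v; have ny := enorm_ge0 y.
have hqv : q * enorm v <= enorm z.
  by rewrite -(@ler_pXn2r _ 2)// ?nnegrE ?mulr_ge0 ?(ltW q0)// exprMn qq.
have hqz : q * enorm z <= 2 * enorm y.
  have [z0|z0] := eqVneq (enorm z) 0; first by rewrite z0 mulr0; lra.
  have zp : 0 < enorm z by rewrite lt_def z0.
  rewrite -(ler_pM2l zp).
  have h1 : q * (1/2 * enorm z ^+ 2) <= q * (enorm v * enorm y) by rewrite ler_wpM2l// ltW.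
  have h2 : (q * enorm v) * enorm y <= enorm z * enorm y by rewrite ler_wpM2r.
  lra.
have hSv : enorm (S *m v) <= 2 * r * enorm z.
  have [s0|s0] := eqVneq (enorm (S *m v)) 0; first by rewrite s0 !mulr_ge0.
  have sp : 0 < enorm (S *m v) by rewrite lt_def s0 enorm_ge0.
  rewrite -(ler_pM2l sp) -expr2 enorm_sqr -{2}Wz mulmxA.
  apply: (le_trans (ler_norm _)); apply: (le_trans (hS _ _)).
  by rewrite mulrCA.
rewrite -mulmxA -/v; apply: (le_trans hSv).
rewrite -(ler_pM2l q0).
have h1 : 2 * r * (q * enorm z) <= 2 * r * (2 * enorm y) by rewrite ler_wpM2l ?mulr_ge0.
have h2 : 4 * r * enorm y <= eps * q * enorm y by rewrite ler_wpM2r.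
lra.
Qed.

End Deterministic.

(** * States and innovations as linear forms in the noise *)

Section Forms.
Context {R : realType} (d t : nat) (A : 'M[R]_d).
Local Notation I := (nat * 'I_d)%type.

(** There are [t.+1] time indices because the correlation involves [eta_{t+1}], although the states
    up to [x_t] use only the first [t] noise vectors. *)
Definition noise_index : seq I := [seq (k, i) | k <- iota 0 t.+1, i <- enum 'I_d].

Lemma noise_index_uniq : uniq noise_index.
Proof.
by apply: allpairs_uniq; [exact: iota_uniq|exact: enum_uniq|move=> [? ?] [? ?]].
Qed.

Lemma big_noise_index (F : I -> R) :
  \sum_(p <- noise_index) F p = \sum_(k < t.+1) \sum_(i < d) F (k : nat, i).
Proof.
rewrite big_allpairs -(big_mkord xpredT (fun k => \sum_(i < d) F (k, i))).
rewrite /index_iota subn0; apply: eq_bigr => k _.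
by rewrite big_enum.
Qed.

Definition noise (x : I -> R) (k : nat) : 'cV[R]_d := \col_i x (k, i).

Lemma sqnorm_noise x :
  sqnorm noise_index x = \sum_(k < t.+1) dotv (noise x k) (noise x k).
Proof.
rewrite /sqnorm big_noise_index; apply: eq_bigr => k _; apply: eq_bigr => i _.
by rewrite !mxE expr2.
Qed.

Lemma sqnorm_noise_widen x :
  \sum_(k < t) dotv (noise x k) (noise x k) <= sqnorm noise_index x.
Proof. by rewrite sqnorm_noise big_ord_recr/= lerDl dotv_ge0. Qed.

Lemma sqnorm_noise_shift x :
  \sum_(k < t) dotv (noise x k.+1) (noise x k.+1) <= sqnorm noise_index x.
Proof. by rewrite sqnorm_noise big_ord_recl/= lerDr dotv_ge0. Qed.

(* Coefficients of [<v, x_{s+1}>] and of [<th, eta_{s+2}>] as linear forms in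
   the noise; the pair [(k, i)] indexes the coordinate [i] of [eta_{k+1}]. *)
Definition state_form (v : 'cV[R]_d) (s : 'I_t) : I -> R :=
  fun p => if (p.1 <= s)%N then ((A ^+ (s - p.1))^T *m v) p.2 0 else 0.

Definition noise_form (th : 'cV[R]_d) (s : 'I_t) : I -> R :=
  fun p => if p.1 == s.+1 then th p.2 0 else 0.

(** The state [x_{s+1}], summed over the range of a block row of [toeplitz_Gamma]. *)
Definition trajectory x (s : nat) :=
  \sum_(k < t | (k <= s)%N) A ^+ (s - k) *m noise x k.

Lemma lin_state_form v s x :
  lin (state_form v s) noise_index x = dotv v (trajectory x s).
Proof.
rewrite /lin big_noise_index big_ord_recr/=.
rewrite [X in _ + X]big1 ?addr0; last first.
  by move=> i _; rewrite /state_form/= leqNgt ltn_ord mul0r.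
rewrite /trajectory [in RHS]big_mkcond/= dotv_sumr; apply: eq_bigr => k _.
case: ifPn => ks; last first.
  by rewrite dotv0 big1// => i _; rewrite /state_form/= (negPf ks) mul0r.
rewrite dotv_mulmx; apply: eq_bigr => i _.
by rewrite /state_form/= ks [noise _ _ _ _]mxE.
Qed.

Lemma lin_noise_form th s x :
  lin (noise_form th s) noise_index x = dotv th (noise x s.+1).
Proof.
rewrite /lin big_noise_index (bigD1 (lift ord0 s))//= [X in _ + X]big1 ?addr0.
  by apply: eq_bigr => i _; rewrite /noise_form/= eqxx mxE.
move=> k ks; rewrite big1// => i _; rewrite /noise_form/=.
case: eqP => [e|]; last by rewrite mul0r.
by move: ks; rewrite -val_eqE/= /bump e leq0n eqxx.
Qed.

Lemma state_form_bound v x :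
  \sum_(s < t) lin (state_form v s) noise_index x ^+ 2 <=
  dotv v v * opnorm (toeplitz_Gamma A t) ^+ 2 * sqnorm noise_index x.
Proof.
apply: (@le_trans _ _ (dotv v v * \sum_(s < t) dotv (trajectory x s) (trajectory x s))).
  rewrite mulr_sumr; apply: ler_sum => s _; rewrite lin_state_form.
  rewrite -real_normK ?num_real// -!enorm_sqr -exprMn.
  by rewrite lerXn2r ?nnegrE ?mulr_ge0 ?enorm_ge0// cauchy_schwarz.
rewrite -mulrA ler_wpM2l ?dotv_ge0//.
apply: (le_trans (toeplitz_bound A (fun k : 'I_t => noise x k))).
by rewrite ler_wpM2l ?sqr_ge0// sqnorm_noise_widen.
Qed.

Lemma noise_form_bound th x :
  \sum_(s < t) lin (noise_form th s) noise_index x ^+ 2 <=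
  dotv th th * sqnorm noise_index x.
Proof.
apply: (@le_trans _ _ (dotv th th * \sum_(s < t) dotv (noise x s.+1) (noise x s.+1))).
  rewrite mulr_sumr; apply: ler_sum => s _; rewrite lin_noise_form.
  rewrite -real_normK ?num_real// -!enorm_sqr -exprMn.
  by rewrite lerXn2r ?nnegrE ?mulr_ge0 ?enorm_ge0// cauchy_schwarz.
by rewrite ler_wpM2l ?dotv_ge0// sqnorm_noise_shift.
Qed.

Definition cov : 'M[R]_d := \sum_(s < t) gramian A s.

Lemma dotv_cov u v : dotv u (cov *m v) =
  \sum_(s < t) \sum_(k < s.+1) dotv ((A ^+ k)^T *m u) ((A ^+ k)^T *m v).
Proof.
rewrite mulmx_suml dotv_sumr; apply: eq_bigr => s _.
rewrite mulmx_suml dotv_sumr; apply: eq_bigr => k _.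
by rewrite -mulmxA dotv_mulmx.
Qed.

Lemma cov_psd : psd cov.
Proof.
split.
  rewrite linear_sum; apply: eq_bigr => s _ /=.
  rewrite linear_sum; apply: eq_bigr => k _ /=.
  by rewrite trmx_mul trmxK.
move=> x; rewrite dotv_cov; apply: sumr_ge0 => s _; apply: sumr_ge0 => k _.
exact: dotv_ge0.
Qed.

(** This is the mean of [<u, V v>]: [x_{s+1}] has covariance [Gamma_s(A)]. With [u = v] it is also
    the squared Frobenius norm of the state forms. *)
Lemma state_form_trace u v :
  \sum_(p <- noise_index) \sum_(s < t) state_form u s p * state_form v s p =
  dotv u (cov *m v).
Proof.
rewrite exchange_big dotv_cov; apply: eq_bigr => s _ /=.
rewrite big_noise_index.
transitivity (\sum_(k < t.+1 | (k < s.+1)%N)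
    dotv ((A ^+ (s - k))^T *m u) ((A ^+ (s - k))^T *m v)).
  rewrite [RHS]big_mkcond; apply: eq_bigr => k _ /=.
  rewrite ltnS; case: ifPn => ks; last first.
    by rewrite big1// => i _; rewrite /state_form/= (negPf ks) mul0r.
  by apply: eq_bigr => i _; rewrite /state_form/= ks.
rewrite -(big_ord_widen t.+1 (fun k => dotv ((A ^+ (s - k))^T *m u) ((A ^+ (s - k))^T *m v))).
  (* Time reversal [k -> s - k] turns the convolution into the gramian. *)
  rewrite (reindex_inj rev_ord_inj); apply: eq_bigr => k _ /=.
  by rewrite subSS subKn// -ltnS.
by rewrite ltnS ltnW.
Qed.

Lemma state_form_frobenius v :
  \sum_(s < t) sqnorm noise_index (state_form v s) = dotv v (cov *m v).
Proof.
rewrite -state_form_trace exchange_big; apply: eq_bigr => s _.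
by apply: eq_bigr => p _; rewrite expr2.
Qed.

(** The innovation [eta_{s+2}] does not enter [x_{s+1}]: the two forms have disjoint supports, so
    the correlation is already centred. *)
Lemma noise_form_trace th v :
  \sum_(p <- noise_index) \sum_(s < t) noise_form th s p * state_form v s p = 0.
Proof.
rewrite big1// => -[k i] _; rewrite big1// => s _; rewrite /noise_form /state_form/=.
by case: eqP => [->|]; rewrite ?ltnn ?mulr0// mul0r.
Qed.

End Forms.

Section Process.
Context {R : realType} {T : Type} (d t : nat) (A : 'M[R]_d) (eta : nat -> T -> 'cV[R]_d).

Definition eta_coord (p : nat * 'I_d) (w : T) : R := eta p.1.+1 w p.2 ord0.

Lemma noise_eta w k : noise (eta_coord^~ w) k = eta k.+1 w.
Proof. by apply/matrixP => i j; rewrite mxE (ord1 j). Qed.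

Lemma state_trajectory w (s : nat) : (s < t)%N ->
  state A eta s.+1 w = trajectory t A (eta_coord^~ w) s.
Proof.
move=> st.
have -> : state A eta s.+1 w = \sum_(k < s.+1) A ^+ (s - k) *m eta k.+1 w.
  elim: s {st} => [|s IH]; first by rewrite /= mulmx0 add0r big_ord1 mul1mx.
  rewrite [LHS]/= -/(state A eta s.+1 w) IH [RHS]big_ord_recr/= subnn mul1mx.
  congr (_ + _); rewrite mulmx_sumr; apply: eq_bigr => k _.
  rewrite mulmxA; congr (_ *m _); have ks : (k <= s)%N by rewrite -ltnS.
  by rewrite (subSn ks) exprS.
rewrite (big_ord_widen t (fun k => A ^+ (s - k) *m eta k.+1 w))//.
by apply: eq_bigr => k _; rewrite noise_eta.
Qed.

Definition gram_x (w : T) := \sum_(s < t.+1) state A eta s w *m (state A eta s w)^T.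

Definition cross (w : T) := \sum_(s < t.+1) eta s.+1 w *m (state A eta s w)^T.

Lemma olsE w : ols A eta t w = (A *m gram_x w + cross w) *m pinv (gram_x w).
Proof.
congr (_ *m _); rewrite mulmx_sumr -big_split; apply: eq_bigr => s _ /=.
by rewrite mulmxDl mulmxA.
Qed.

Lemma gram_x_sym w : (gram_x w)^T = gram_x w.
Proof. by rewrite linear_sum; apply: eq_bigr => s _ /=; rewrite trmx_mul trmxK. Qed.

Lemma gram_x_bilin w u v : dotv u (gram_x w *m v) =
  bilin (noise_index d t) (state_form A u) (state_form A v : 'I_t -> _) (eta_coord^~ w).
Proof.
(* The term [s = 0] vanishes because [x_0 = 0]; the remaining ones are indexed by ['I_t] with a
   shift of one. *)
rewrite /gram_x big_ord_recl/= mul0mx add0r mulmx_suml dotv_sumr.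
apply: eq_bigr => s _; rewrite dotv_outer !lin_state_form -state_trajectory//.
by rewrite [dotv _ v]dotvC.
Qed.

Lemma cross_bilin w u v : dotv u (cross w *m v) =
  bilin (noise_index d t) (noise_form u) (state_form A v : 'I_t -> _) (eta_coord^~ w).
Proof.
rewrite /cross big_ord_recl/= trmx0 mulmx0 add0r mulmx_suml dotv_sumr.
apply: eq_bigr => s _; rewrite dotv_outer lin_state_form lin_noise_form noise_eta.
by rewrite -state_trajectory// [dotv _ v]dotvC.
Qed.

End Process.

(** * The probability estimate *)

Section Probability.
Context {R : realType} {dT : measure_display} {T : measurableType dT}.
Variable P : probability T R.

Lemma seq_union_bound (I : eqType) (l : seq I) (B : I -> set T) (b : R) :
  (forall i, measurable (B i)) -> {in l, forall i, (P (B i) <= b%:E)%E} ->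
  measurable [set w | exists2 i, i \in l & B i w] /\
  (P [set w | exists2 i, i \in l & B i w] <= ((size l)%:R * b)%:E)%E.
Proof.
move=> mB; elim: l => [|i l IH] hb.
  have -> : [set w | exists2 i, i \in [::] & B i w] = set0.
    by apply/seteqP; split => // w [].
  by rewrite measure0 mul0r; split.
have [mU hU] : measurable [set w | exists2 j, j \in l & B j w] /\
    (P [set w | exists2 j, j \in l & B j w] <= ((size l)%:R * b)%:E)%E.
  by apply: IH => j jl; apply: hb; rewrite inE jl orbT.
have -> : [set w | exists2 j, j \in i :: l & B j w] =
    B i `|` [set w | exists2 j, j \in l & B j w].
  apply/seteqP; split => w.
    by move=> [j]; rewrite inE => /orP[/eqP ->|jl] Bj; [left|right; exists j].
  move=> [Bi|[j jl Bj]]; first by exists i; rewrite ?mem_head.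
  by exists j => //; rewrite inE jl orbT.
split; first exact: measurableU.
apply: (le_trans (measureU2 _ _ _)) => //.
rewrite /= -natr1 mulrDl mul1r addrC EFinD; apply: leeD => //.
by apply: hb; rewrite mem_head.
Qed.

(** Unit variance and [1 + x <= e^x] give [1 + 1/k^2 <= 2] for every admissible [k], so [K >= 1]. To
    avoid asking that the infimum be attained, an admissible [k < K + 1 <= 2 K] is used. *)
Lemma psi2norm_unit_variance (Y : T -> R) (K : R) : measurable_fun setT Y ->
  (\int[P]_w (Y w ^+ 2)%:E = 1)%E -> (psi2norm P Y <= K%:E)%E ->
  1 <= K /\ (\int[P]_w (expR (Y w ^+ 2 / (2 * K) ^+ 2))%:E <= 2%:E)%E.
Proof.
move=> mY EY2 hK.
have mY2 : measurable_fun setT (fun w => Y w ^+ 2) by exact: measurable_funX.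
have me (k : R) : measurable_fun setT (fun w => (expR (Y w ^+ 2 / k ^+ 2))%:E).
  apply/measurable_EFinP; apply: measurableT_comp => //.
  by apply: measurable_funM.
have approx (h : R) : 0 < h -> exists k : R, [/\ 0 < k, k < K + h &
    (\int[P]_w (expR (Y w ^+ 2 / k ^+ 2))%:E <= 2%:E)%E].
  move=> h0; have : (psi2norm P Y < (K + h)%:E)%E.
    by apply: (le_lt_trans hK); rewrite lte_fin ltrDl.
  move=> /ereal_inf_lt[_ [k [k0 hk] <-]]; rewrite lte_fin => kK.
  by exists k; split => //; move: hk; rewrite unlock.
have k_ge1 (k : R) : 0 < k ->
    (\int[P]_w (expR (Y w ^+ 2 / k ^+ 2))%:E <= 2%:E)%E -> 1 <= k.
  move=> k0 hk; have k20 : 0 < k ^+ 2 by exact: exprn_gt0.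
  have : (\int[P]_w (1%:E + (k ^+ 2)^-1%:E * (Y w ^+ 2)%:E) <= 2%:E)%E.
    apply: le_trans hk; apply: ge0_le_integral => //.
    - by move=> w _; rewrite -EFinM -EFinD lee_fin addr_ge0// mulr_ge0 ?sqr_ge0// invr_ge0 ltW.
    - by apply: emeasurable_funD => //; apply: measurable_funeM; exact/measurable_EFinP.
    - by move=> w _; rewrite -EFinM -EFinD lee_fin [_^-1 * _]mulrC expR_ge1Dx.
  rewrite ge0_integralD//; last 2 first.
    - by move=> w _; rewrite -EFinM lee_fin mulr_ge0 ?sqr_ge0// invr_ge0 ltW.
    - by apply: measurable_funeM; exact/measurable_EFinP.
  rewrite ge0_integralZl//; last 3 first.
    - exact/measurable_EFinP.
    - by move=> w _; rewrite lee_fin sqr_ge0.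
    - by rewrite lee_fin invr_ge0 ltW.
  rewrite EY2 integral_cst//= probability_setT !mule1 -EFinD lee_fin => h.
  have : (k ^+ 2)^-1 * k ^+ 2 <= 1 * k ^+ 2 by rewrite ler_wpM2r ?(ltW k20)//; lra.
  rewrite mulVf ?gt_eqF// mul1r => h2.
  by rewrite -(@ler_pXn2r _ 2)// ?nnegrE ?(ltW k0)// expr1n.
have K1 : 1 <= K.
  apply/ler_addgt0Pr => h /approx[k [k0 kK hk]].
  by apply: (le_trans (k_ge1 k k0 hk)); exact: ltW.
split => //; have [k [k0 kK hk]] := approx 1 ltr01.
apply: le_trans hk; apply: ge0_le_integral => //.
move=> w _; rewrite lee_fin ler_expR ler_wpM2l ?sqr_ge0//.
  rewrite lef_pV2 ?posrE ?exprn_gt0//; last lra.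
  by rewrite lerXn2r// ?nnegrE; lra.
Qed.

End Probability.

(** * Numerical constants *)

Section FailureProbability.
Context {R : realType}.

(** The factor [2 ^+ (36 * d)] counts pairs of net points and 4 counts two families with two tails
    each. As [2 <= e] and [d >= 1], [39 = 36 + 2 + 1] suffices. *)
Lemma union_exponent (d : nat) (delta L : R) : (0 < d)%N -> 0 < delta < 1 ->
  L = ln (delta^-1) + d%:R ->
  2 ^+ (36 * d) * (4 * expR (- (39 * L))) < delta.
Proof.
move=> d0 /andP[dl0 dl1] ->.
have l0 : 0 < ln (delta^-1) by rewrite ln_gt0// invf_gt1.
have d1 : 1 <= d%:R :> R by rewrite ler1n.
have e2 n : (2 : R) ^+ n <= expR n%:R.
  rewrite -[n%:R]mulr1 expRM_natl lerXn2r// ?nnegrE ?expR_ge0//.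
  by have := expR_ge1Dx (1 : R); lra.
have -> : 2 ^+ (36 * d) * (4 * expR (- (39 * (ln (delta^-1) + d%:R)))) =
   2 ^+ (36 * d + 2) * expR (- (39 * (ln (delta^-1) + d%:R))).
  by rewrite exprD mulrA; congr (_ * _ * _); rewrite expr2 -natrM.
apply: (@le_lt_trans _ _ (expR ((36 * d + 2)%N%:R) *
    expR (- (39 * (ln (delta^-1) + d%:R))))).
  by rewrite ler_wpM2r ?expR_ge0.
rewrite -expRD -[ltRHS]lnK ?posrE// ltr_expR.
have -> : ln delta = - ln (delta^-1) by rewrite lnV ?posrE// opprK.
rewrite natrD natrM; lra.
Qed.

End FailureProbability.

Section Exponents.
Context {R : realType}.

Lemma measurable_mx_ols {dT : measure_display} {T : measurableType dT} (d : nat)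
    (A : 'M[R]_d) (eta : nat -> T -> 'cV[R]_d) (t : nat) :
  (forall s, (0 < s)%N -> measurable_mx (eta s)) -> measurable_mx (ols A eta t).
Proof.
move=> meta.
have mstate s : measurable_mx (state A eta s).
  elim: s => [|s IH]; first exact: measurable_mx_cst.
  by apply: measurable_mxD; [exact: (measurable_mxM (measurable_mx_cst A) IH)|exact: meta].
apply: measurable_mxM; last first.
  by apply: measurable_mx_pinv; apply: measurable_mx_sum => s;
    exact: measurable_mxM (mstate _) (measurable_mx_tr (mstate _)).
by apply: measurable_mx_sum => s;
    exact: measurable_mxM (mstate _) (measurable_mx_tr (mstate _)).
Qed.

(* The exponents in [bilin_tail] for the two families of forms, with
   [q = K ^ 4] and [L] the logarithmic factor. *)
Lemma covariance_exponent (C kap q L lam : R) : 1 <= q -> 0 < L ->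
  C = 2 ^+ 10 * q -> kap = (8 * C)^-1 -> lam = kap * (2 ^+ 30 * q * L) / 8 ->
  [/\ 0 <= lam,
      lam ^+ 2 * ((2 ^+ 30 * q * L)^-1 * (2 ^+ 30 * q * L)^-1) <= kap ^+ 2 &
      4 * C * (lam ^+ 2 * (2 ^+ 30 * q * L)^-1) - lam * (1 / 4) <= - (39 * L)].
Proof.
move=> q1 L0 -> -> ->.
have q0 : 0 < q by lra.
split.
- by rewrite !mulr_ge0 ?invr_ge0 ?mulr_ge0 ?exprn_ge0 ?ltW.
- rewrite [leLHS](_ : _ = ((8 * (2 ^+ 10 * q))^-1) ^+ 2 / 64).
    by have := sqr_ge0 ((8 * (2 ^+ 10 * q))^-1); lra.
  by field; rewrite !gt_eqF.
- rewrite [leLHS](_ : _ = - (3072 * L)); first lra.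
  by field; rewrite !gt_eqF.
Qed.

Lemma cross_exponent (C kap q L lam rho : R) : 1 <= q -> 0 < L ->
  C = 2 ^+ 10 * q -> kap = (8 * C)^-1 -> lam ^+ 2 = L / q ->
  lam * rho = 2 ^+ 13 * L ->
  lam ^+ 2 * (1 * (2 ^+ 30 * q * L)^-1) <= kap ^+ 2 /\
  4 * C * (lam ^+ 2 * 1) - lam * rho <= - (39 * L).
Proof.
move=> q1 L0 -> -> -> ->.
have q0 : 0 < q by lra.
split.
- rewrite [leLHS](_ : _ = ((8 * (2 ^+ 10 * q))^-1) ^+ 2 / 16).
    by have := sqr_ge0 ((8 * (2 ^+ 10 * q))^-1); lra.
  by field; rewrite !gt_eqF.
- rewrite [leLHS](_ : _ = - (4096 * L)); first lra.
  by field; rewrite !gt_eqF.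
Qed.

End Exponents.

(** * Assembly of the probability bound *)

Unset Implicit Arguments.
Set Strict Implicit.

Theorem theorem1 :
  forall R : realType, exists c' : R, 0 < c' /\
  forall (d : nat) (A : 'M[R]_d) (K : R)
    (dT : measure_display) (T : measurableType dT) (P : probability T R)
    (eta : nat -> T -> 'cV[R]_d),
  (0 < d)%N ->
  spectral_radius A < 1 ->
  (* eta_1, eta_2, ... are random vectors (coordinates measurable) *)
  (forall (s : nat) (i : 'I_d), (0 < s)%N ->
     measurable_fun setT (fun w => eta s w i ord0)) ->
  (* independence across s and of the coordinates of each eta_s *)
  mutually_independent P (fun p : nat * 'I_d => fun w => eta p.1.+1 w p.2 ord0) ->
  (* identically distributed *)
  (forall (s : nat) (i : 'I_d) (B : set R), (0 < s)%N -> measurable B ->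
     P ((fun w => eta s w i ord0) @^-1` B) = P ((fun w => eta 1%N w i ord0) @^-1` B)) ->
  (* zero mean *)
  (forall (s : nat) (i : 'I_d), (0 < s)%N ->
     ('E_P[fun w => eta s w i ord0] = 0)%E) ->
  (* isotropic: E eta_s eta_s^T = I_d *)
  (forall (s : nat) (i j : 'I_d), (0 < s)%N ->
     ('E_P[fun w => (eta s w i ord0 * eta s w j ord0)%R] = ((i == j)%:R : R)%:E)%E) ->
  (* psi_2-norms of the coordinates at most K *)
  (forall (s : nat) (i : 'I_d), (0 < s)%N ->
     (psi2norm P (fun w => eta s w i ord0) <= K%:E)%E) ->
  forall (t : nat) (delta eps : R),
  (1 <= t)%N -> 0 < delta < 1 -> 0 < eps ->
  c' * K ^+ 4 * Num.max (eps ^-2) (opnorm (toeplitz_Gamma A t) ^+ 2)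
    * (ln (delta^-1) + d%:R)
    <= lambda_min (\sum_(s < t) gramian A s) ->
  (P [set w | (eps < opnorm (ols A eta t w - A))%R] < delta%:E)%E.
Proof.
move=> R; exists (2 ^+ 30); split; first by rewrite exprn_gt0.
move=> d A K dT T P eta d0 _ meta indep _ mean0 iso psi t delta eps t1 hdelta eps0 hmin.
pose i0 : 'I_d := Ordinal d0.
pose X := eta_coord eta.
have mX p : measurable_fun setT (X p) by exact: meta.
have EX p : (\int[P]_w (X p w)%:E = 0)%E.
  by have := mean0 p.1.+1 p.2 isT; rewrite unlock.
have EX2 p : (\int[P]_w (X p w ^+ 2)%:E = 1)%E.
  have := iso p.1.+1 p.2 p.2 isT; rewrite unlock eqxx => <-.
  by apply: eq_integral => w _; rewrite expr2.
have hpsi p := psi2norm_unit_variance (mX p) (EX2 p) (psi p.1.+1 p.2 isT).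
have [K1 _] := hpsi (0%N, i0).
have K0 : 0 < K by lra.
have K20 : 0 < K ^+ 2 by rewrite exprn_gt0.
pose q := K ^+ 4; have q1 : 1 <= q by rewrite exprn_ege1.
have q0 : 0 < q by rewrite (lt_le_trans ltr01).
(* [C] is the constant of [mgf_linear_quadratic] at [k = 2 K], and [kap] the largest value that
   [Ckap] allows. *)
pose C := 64 * (2 * K) ^+ 4; pose kap := (8 * C)^-1.
have CE : C = 2 ^+ 10 * q by rewrite /C /q; ring.
have C0 : 0 < C by rewrite CE mulr_gt0// exprn_gt0.
have kap0 : 0 <= kap by rewrite invr_ge0 mulr_ge0// ltW.
have Ckap : 8 * C * kap <= 1 by rewrite mulfV// gt_eqF// mulr_gt0.
have mgfX p a b : `|b| <= kap ->
    (\int[P]_w (expR (a * X p w + b * X p w ^+ 2))%:E <=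
     (expR (b + C * (a ^+ 2 + b ^+ 2)))%:E)%E.
  move=> hb; apply: mgf_linear_quadratic => //.
  - by lra.
  - by have [] := hpsi p.
  - apply: (le_trans hb); rewrite /kap lef_pV2 ?posrE ?mulr_gt0// ?exprn_gt0// ?mulr_gt0//.
    rewrite /C; have : 1 <= (2 * K) ^+ 2 by rewrite exprn_ege1//; lra.
    have -> : (2 * K) ^+ 4 = (2 * K) ^+ 2 * (2 * K) ^+ 2 by rewrite -exprD.
    by nra.
pose L : R := ln (delta^-1) + d%:R.
have L0 : 0 < L.
  have /andP[dl0 dl1] := hdelta.
  by rewrite addr_gt0 ?ltr0n// ln_gt0// invf_gt1.
pose Lb : R := 2 ^+ 30 * q * L.
have Lb0 : 0 < Lb by rewrite mulr_gt0// mulr_gt0// exprn_gt0.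
pose mu := lambda_min (cov t A).
pose g := opnorm (toeplitz_Gamma A t) ^+ 2.
have hmax m : m <= Num.max (eps ^- 2) g -> Lb * m <= mu.
  move=> hm; apply: le_trans hmin.
  by rewrite [leRHS]mulrAC -/q -/L -/Lb ler_wpM2l ?(ltW Lb0).
have hmu_eps : Lb * eps ^- 2 <= mu by apply: hmax; rewrite le_max lexx.
have hmu_g : Lb * g <= mu by apply: hmax; rewrite le_max lexx orbT.
have mu0 : 0 < mu.
  apply: lt_le_trans hmu_eps; apply: mulr_gt0 => //.
  by rewrite invr_gt0; exact: exprn_gt0.
have hmu x : mu * dotv x x <= dotv x (cov t A *m x).
  by apply: lambda_min_rayleigh; exact: cov_psd.
have [W hW] : exists W : 'M[R]_d, W^T *m cov t A *m W = 1%:M.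
  apply: congruence_to_identity; first by have [] := cov_psd t A.
  move=> x x0; apply: lt_le_trans (hmu x); rewrite mulr_gt0// lt_def dotv_ge0 andbT.
  by apply: contra x0 => /eqP/dotv_eq0 ->.
have adj (x y : 'cV[R]_d) : dotv (W *m x) y = dotv x (W^T *m y).
  by rewrite [RHS]dotv_mulmx trmxK.
have WC x y : dotv (W *m x) (cov t A *m (W *m y)) = dotv x y.
  by rewrite adj !mulmxA hW mul1mx.
have [s [hs s1 snet]] := @unit_ball_net R d d0.
have dots v : v \in s -> dotv v v <= 1.
  by move=> vs; rewrite -enorm_sqr expr_le1 ?enorm_ge0// s1.
pose beta := Lb^-1.
have beta0 : 0 < beta by rewrite invr_gt0.
(* The squared norm is at most [|W v|^2 |Gamma|^2], where [mu |W v|^2 <= |v|^2 <= 1] and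
   [Lb |Gamma|^2 <= mu]. *)
have stateP v : v \in s -> forall x, \sum_(k < t)
    lin (state_form A (W *m v) k) (noise_index d t) x ^+ 2 <=
    beta * sqnorm (noise_index d t) x.
  move=> vs x; apply: (le_trans (state_form_bound t A _ x)).
  rewrite ler_wpM2r ?sqnorm_ge0// -/g -(ler_pM2l Lb0) mulfV ?gt_eqF//.
  apply: (le_trans _ (dots v vs)); rewrite -(WC v v); apply: le_trans (hmu _).
  by rewrite mulrCA mulrC ler_wpM2r ?dotv_ge0.
have stateF v : v \in s ->
    \sum_(k < t) sqnorm (noise_index d t) (state_form A (W *m v) k) <= 1.
  by move=> vs; rewrite state_form_frobenius WC dots.
have noiseP v : v \in s -> forall x, \sum_(k < t)
    lin (noise_form v k) (noise_index d t) x ^+ 2 <= 1 * sqnorm (noise_index d t) x.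
  move=> vs x; apply: (le_trans (noise_form_bound t _ x)).
  by rewrite ler_wpM2r ?sqnorm_ge0// dots.
(* Within a factor 8 of the limit [lam beta <= kap]; a constant deviation makes the linear term
   dominate there. *)
pose lam1 := kap * Lb / 8.
have [l10 l1 e1] := covariance_exponent q1 L0 CE erefl (erefl lam1).
pose lam2 := Num.sqrt L / K ^+ 2.
(* With this [r], [lam2 r] is twice the quadratic term [4 C lam2^2], and [(4 r)^2 = Lb]. The second
   identity fixes the constant [2 ^+ 30]. *)
pose r := 2 ^+ 13 * K ^+ 2 * Num.sqrt L.
have l2sq : lam2 ^+ 2 = L / q.
  by rewrite expr_div_n sqr_sqrtr ?ltW// -exprM.
have l2r : lam2 * r = 2 ^+ 13 * L.
  rewrite -[in RHS](sqr_sqrtr (ltW L0)) /lam2 /r; field; lra.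
have [l2 e2] := cross_exponent q1 L0 CE erefl l2sq l2r.
have l20 : 0 <= lam2 by rewrite divr_ge0 ?sqrtr_ge0// ltW.
have r0 : 0 <= r by rewrite !mulr_ge0 ?sqrtr_ge0 ?exprn_ge0// ltW.
pose l := [seq (v, w) | v <- s, w <- s].
(* [F] selects the family: state forms for the covariance, noise forms for the correlation. *)
pose Z (F : 'cV[R]_d -> 'I_t -> nat * 'I_d -> R) (p : 'cV[R]_d * 'cV[R]_d) om :=
  bilin (noise_index d t) (F p.1) (state_form A (W *m p.2)) (X^~ om).
pose tr (F : 'cV[R]_d -> 'I_t -> nat * 'I_d -> R) (p : 'cV[R]_d * 'cV[R]_d) :=
  \sum_(i <- noise_index d t) \sum_(k < t) F p.1 k i * state_form A (W *m p.2) k i.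
pose B F rho p := [set om | rho < `|Z F p om - tr F p|].
have mB F rho p : measurable (B F rho p).
  apply: measurable_lt_set => //; apply: measurableT_comp => //.
  by apply: measurable_funB => //; exact: measurable_bilin.
pose F1 v : 'I_t -> nat * 'I_d -> R := state_form A (W *m v).
pose F2 v : 'I_t -> nat * 'I_d -> R := noise_form v.
have b1 : {in l, forall p, (P (B F1 (1 / 4)%R p) <= (2 * expR (- (39 * L)))%:E)%E}.
  move=> p /allpairsP[[v w] [vs ws ->]] /=.
  have := bilin_tail mX indep (ltW C0) kap0 Ckap mgfX (noise_index_uniq d t)
    (ltW beta0) (stateP v vs) (stateP w ws) (stateF w ws) (1/4) l10 l1.
  move=> h; apply: (le_trans h); rewrite lee_fin ler_wpM2l// ler_expR; exact: e1.
have b2 : {in l, forall p, (P (B F2 r p) <= (2 * expR (- (39 * L)))%:E)%E}.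
  move=> p /allpairsP[[v w] [vs ws ->]] /=.
  have := bilin_tail mX indep (ltW C0) kap0 Ckap mgfX (noise_index_uniq d t)
    ler01 (noiseP v vs) (stateP w ws) (stateF w ws) r l20 l2.
  move=> h; apply: (le_trans h); rewrite lee_fin ler_wpM2l// ler_expR; exact: e2.
have [mU1 hU1] := seq_union_bound (mB F1 (1/4)) b1.
have [mU2 hU2] := seq_union_bound (mB F2 r) b2.
set U1 := [set _ | _] in mU1 hU1; set U2 := [set _ | _] in mU2 hU2.
have size_l : (size l)%:R <= 2 ^+ (36 * d) :> R.
  rewrite size_allpairs natrM.
  have -> : (36 * d = 18 * d + 18 * d)%N by rewrite -mulnDl.
  by rewrite exprD ler_pM.
have PU : (P (U1 `|` U2) < delta%:E)%E.
  apply: (le_lt_trans (measureU2 _ mU1 mU2)).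
  apply: (le_lt_trans (leeD hU1 hU2)); rewrite -EFinD lte_fin.
  apply: le_lt_trans (union_exponent d0 hdelta (erefl L)).
  rewrite -mulrDr (_ : _ + _ = 4 * expR (- (39 * L))); last by ring.
  by rewrite ler_wpM2r// mulr_ge0// expR_ge0.
apply: le_lt_trans PU; apply: le_measure; rewrite ?inE.
- apply: measurable_opnorm_gt => //; apply: measurable_mxB; last exact: measurable_mx_cst.
  apply: measurable_mx_ols => k k0 i j; rewrite (ord1 j); exact: meta.
- exact: measurableU.
move=> om /= hom; apply: contrapT => /not_orP[n1 n2].
suff h : opnorm (ols A eta t om - A) <= eps by have := lt_le_trans hom h; rewrite ltxx.
rewrite olsE.
have cov_sym := (cov_psd t A).1.
apply: (@least_squares_error R d A (cov t A) _ _ W mu r eps) => //; last first.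
- apply: (bilinear_net s1 snet) => v w vs ws.
  rewrite -mulmxA cross_bilin.
  rewrite leNgt; apply/negP => h; apply: n2; exists (v, w); first exact: allpairs_f.
  by rewrite /B/= /Z /tr noise_form_trace subr0.
- apply: (bilinear_net s1 snet) => v w vs ws.
  rewrite -!mulmxA -adj mulmxBl dotvBr gram_x_bilin -state_form_trace.
  rewrite leNgt; apply/negP => h; apply: n1.
  by exists (v, w); first exact: allpairs_f.
- exact: gram_x_sym.
- have m0 := sqrtr_ge0 mu.
  rewrite -(@ler_pXn2r _ 2)// ?nnegrE; last 2 first.
  + by rewrite mulr_ge0.
  + by rewrite mulr_ge0// ltW.
  rewrite [leRHS]exprMn sqr_sqrtr ?(ltW mu0)//.
  (* After squaring, the requirement is [Lb <= eps^2 mu], the [eps] part of the hypothesis on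
     [lambda_min]. *)
  have -> : (4 * r) ^+ 2 = Lb.
    by rewrite /Lb -[in RHS](sqr_sqrtr (ltW L0)) /r /q; ring.
  by rewrite mulrC -ler_pdivrMr ?exprn_gt0.
Qed.
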